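(* For each $L\in\mathbb{N}$ let $(\eta^L(t))_{t\in\mathbb{Z}_+}$ be the RBB process with $L$ bins, with random initial state $\eta^L(0)\in\mathbb{Z}_+^L$ whose law is finitely exchangeable (invariant under permutations of the $L$ coordinates). Assume there is a probability measure $\mu$ on $\mathbb{Z}_+$ such that for every $n\in\mathbb{N}$ and all $\xi_1,\dots,\xi_n\in\mathbb{Z}_+$, $$\lim_{L\to\infty}\mathbb{P}(\eta^L_1(0)=\xi_1,\dots,\eta^L_n(0)=\xi_n)=\prod_{k=1}^n\mu(\{\xi_k\}).$$ Then for every $L$ and $t$ the law of $\eta^L(t)$ is finitely exchangeable, and for every $T\in\mathbb{N}$, every $n\in\mathbb{N}$ and all bounded functions $\Phi_1,\dots,\Phi_n:\mathbb{Z}_+^{T+1}\to\mathbb{R}$, $$\lim_{L\to\infty}\mathbb{E}\Big[\prod_{k=1}^n\Phi_k(\eta^L_k(0),\eta^L_k(1),\dots,\eta^L_k(T))\Big]=\prod_{k=1}^n\mathbb{E}\big[\Phi_k(\eta(0),\eta(1),\dots,\eta(T))\big],$$ where $(\eta(t))_{t\in\mathbb{Z}_+}$ is the nonlinear process with initial law $\eta(0)\sim\mu$.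
   Context: Repeated Balls-into-Bins (RBB) process with $L$ bins: a Markov chain $(\eta^L(t))_{t\in\mathbb{Z}_+}$ on $\mathbb{Z}_+^L$. For $\eta\in\mathbb{Z}_+^L$ let $w(\eta):=(\mathbf{1}(\eta_1>0),\dots,\mathbf{1}(\eta_L>0))$ and $K(\eta):=\sum_{j=1}^L\mathbf{1}(\eta_j>0)$. If $\eta^L(t)=\eta$, then $\eta^L(t+1)=\eta-w(\eta)+B(\eta)$, where, conditionally on the past, $B(\eta)$ is multinomial with $K(\eta)$ trials and cell probabilities $(1/L,\dots,1/L)$; i.e. one ball is removed from every nonempty bin and each removed ball is placed independently in a uniformly chosen bin. The nonlinear process $(\eta(t))_{t\in\mathbb{Z}_+}$ takes values in $\mathbb{Z}_+$: $\eta(0)$ has a given distribution; given $\eta(t)$, set $\rho(t):=\mathbb{P}(\eta(t)>0)$, let $N_{t+1}$ be Poisson with mean $\rho(t)$ (mean $0$ meaning identically $0$), independent of everything before, and set $\eta(t+1):=\eta(t)-\mathbf{1}(\eta(t)>0)+N_{t+1}$. *)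

(* Defs.v *)
From Stdlib Require Export Reals List Permutation Arith.
Import ListNotations.
Open Scope R_scope.

Definition Rsum (l : list R) : R := fold_right Rplus 0 l.
Definition Rprod (l : list R) : R := fold_right Rmult 1 l.

Definition has_sum {X : Type} (f : X -> R) (s : R) : Prop :=
  forall eps, 0 < eps -> exists S0 : list X,
    forall S : list X, NoDup S -> incl S0 S -> Rabs (Rsum (map f S) - s) < eps.

Definition wbit (a : nat) : nat := if Nat.eqb a 0 then 0%nat else 1%nat.
Definition occ (x : list nat) : nat := list_sum (map wbit x).
(* y - (x - w(x)) >= 0 componentwise *)
Definition feasible (x y : list nat) : bool :=
  forallb (fun p => Nat.leb (fst p) (snd p + wbit (fst p))) (combine x y).
Definition bvec (x y : list nat) : list nat :=
  map (fun p => (snd p + wbit (fst p) - fst p)%nat) (combine x y).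
Definition multinom (L K : nat) (b : list nat) : R :=
  if Nat.eqb (list_sum b) K
  then INR (fact K) / Rprod (map (fun k => INR (fact k)) b) * (/ INR L) ^ K
  else 0.
Definition rbb_kernel (L : nat) (x y : list nat) : R :=
  if (Nat.eqb (length x) L && Nat.eqb (length y) L && feasible x y)%bool
  then multinom L (occ x) (bvec x y) else 0.

(* all lists z with length z = length y and z_i <= y_i + 1 (contains every
   predecessor state x with rbb_kernel L x y <> 0) *)
Fixpoint box (y : list nat) : list (list nat) :=
  match y with
  | [] => [[]]
  | a :: y' => flat_map (fun z => map (fun i => i :: z) (seq 0 (a + 2))) (box y')
  end.

Fixpoint rbb_law (L : nat) (p0 : list nat -> R) (t : nat) (y : list nat) : R :=
  match t with
  | O => p0 y
  | S t' => Rsum (map (fun x => rbb_law L p0 t' x * rbb_kernel L x y) (box y))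
  end.

Fixpoint rbb_chain (L : nat) (x : list nat) (r : list (list nat)) : R :=
  match r with
  | [] => 1
  | y :: r' => rbb_kernel L x y * rbb_chain L y r'
  end.
Definition rbb_path (L : nat) (p0 : list nat -> R) (path : list (list nat)) : R :=
  match path with
  | [] => 0
  | x0 :: r => p0 x0 * rbb_chain L x0 r
  end.

Definition poisson (m : R) (k : nat) : R := exp (- m) * m ^ k / INR (fact k).
(* P(eta(t+1) = y | eta(t) = x) when N ~ Poisson(rho); rho = 0 gives N = 0 *)
Definition nl_step (rho : R) (x y : nat) : R :=
  if Nat.eqb x 0 then poisson rho y
  else if Nat.ltb (y + 1) x then 0 else poisson rho (y + 1 - x).

(* law of eta(t); rho(t) = P(eta(t) > 0) = 1 - P(eta(t) = 0) *)
Fixpoint nl_law (mu : nat -> R) (t : nat) : nat -> R :=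
  match t with
  | O => mu
  | S t' => let q := nl_law mu t' in
            fun y => Rsum (map (fun x => q x * nl_step (1 - q 0%nat) x y) (seq 0 (y + 2)))
  end.
Definition nl_rho (mu : nat -> R) (t : nat) : R := 1 - nl_law mu t 0%nat.

Fixpoint nl_chain (mu : nat -> R) (t : nat) (x : nat) (r : list nat) : R :=
  match r with
  | [] => 1
  | y :: r' => nl_step (nl_rho mu t) x y * nl_chain mu (S t) y r'
  end.
Definition nl_path (mu : nat -> R) (path : list nat) : R :=
  match path with
  | [] => 0
  | x0 :: r => mu x0 * nl_chain mu 0 x0 r
  end.

(* Main.v *)
Require Import Defs.
From Stdlib Require Import Reals List Permutation Arith.
From Stdlib Require Import Lra Lia Classical ClassicalEpsilon FunctionalExtensionality.
Import ListNotations.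
Open Scope R_scope.

(* By exchangeability, two-bin chaos at time t makes the variance of the occupied fraction K/L tend to 0,
   so K/L concentrates at rho(t) = P(eta(t) > 0). Given the present state, the arrivals in the first n bins
   are a multinomial marginal, which is Lipschitz-close to a product of Poisson(rho(t)) weights with error
   O(1/L + |K/L - rho(t)|). Hence the mass of any prefix event carried through one transition converges.
   A predecessor of y is bounded by y + 1 coordinatewise, so summing over the past of a prefix is a finite sum
   and chaos propagates from t to t + 1; iterating along a path gives convergence of the joint law of the
   first n trajectories at every point. The limit is a probability, so Scheffe's argument upgrades this to
   convergence against bounded functions. *)

(** * Finite sums and products *)

(** The first [n] bins are not a Markov chain: their transition sees the other bins through the
    number [K] of occupied ones. Hence mass functions of the whole state are carried along, cut down
    to states with a prescribed prefix, and the kernel is compared with a constant on each such set.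
    The error is [|K/L - rho|] averaged on a past event; the restricted mass is dominated by the
    full law of that time, so the law of large numbers for the full law is enough and no conditional
    version of it is needed. Exchangeability is carried through time because it lets a statement on
    two fixed bins speak of all pairs of bins. All expectations are unordered sums: Tonelli handles
    nonnegative terms, and signed integrands are reduced to it by adding a dominating function and
    subtracting its sum. *)

Definition ceq {X : Type} (a b : X) : {a = b} + {a <> b} :=
  excluded_middle_informative (a = b).

Section FiniteSums.
Context {X : Type}.
Implicit Types (f g : X -> R) (l : list X).

Lemma Rsum_app (u w : list R) : Rsum (u ++ w) = Rsum u + Rsum w.
Proof. induction u as [|a u IH]; simpl; [lra|rewrite IH; lra]. Qed.

Lemma Rsum_perm (u w : list R) : Permutation u w -> Rsum u = Rsum w.
Proof. induction 1; simpl; lra. Qed.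

Lemma Rsum_map_ext f g l : (forall x, In x l -> f x = g x) -> Rsum (map f l) = Rsum (map g l).
Proof. intros H. f_equal. now apply map_ext_in. Qed.

Lemma Rsum_map_plus f g l :
  Rsum (map (fun x => f x + g x) l) = Rsum (map f l) + Rsum (map g l).
Proof. induction l as [|a l IH]; simpl; [lra|rewrite IH; lra]. Qed.

Lemma Rsum_map_scal c f l : Rsum (map (fun x => c * f x) l) = c * Rsum (map f l).
Proof. induction l as [|a l IH]; simpl; [lra|rewrite IH; lra]. Qed.

Lemma Rsum_map_le f g l : (forall x, In x l -> f x <= g x) -> Rsum (map f l) <= Rsum (map g l).
Proof.
  induction l as [|a l IH]; intros H; simpl; [lra|].
  apply Rplus_le_compat; [apply H; now left|apply IH; intros; apply H; now right].
Qed.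

Lemma Rsum_map_zero f l : (forall x, In x l -> f x = 0) -> Rsum (map f l) = 0.
Proof.
  induction l as [|a l IH]; intros H; simpl; [lra|].
  rewrite (H a), IH; [lra| |now left]. intros; apply H; now right.
Qed.

Lemma Rsum_map_nonneg f l : (forall x, In x l -> 0 <= f x) -> 0 <= Rsum (map f l).
Proof.
  intros H. rewrite <- (Rsum_map_zero (fun _ => 0) l) by reflexivity.
  now apply Rsum_map_le.
Qed.

Lemma Rsum_map_const c l : Rsum (map (fun _ => c) l) = INR (length l) * c.
Proof. induction l as [|a l IH]; [simpl; lra|]. cbn [map Rsum fold_right length]. rewrite S_INR. unfold Rsum in IH. rewrite IH. lra. Qed.

End FiniteSums.

Lemma Rsum_swap {X Y : Type} (f : X -> Y -> R) l (k : list Y) :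
  Rsum (map (fun x => Rsum (map (f x) k)) l) = Rsum (map (fun y => Rsum (map (fun x => f x y) l)) k).
Proof.
  induction l as [|a l IH]; simpl.
  - symmetry. now apply Rsum_map_zero.
  - rewrite IH. symmetry. apply Rsum_map_plus.
Qed.

Lemma Rsum_flat_map {X Y : Type} (g : X -> list Y) (f : Y -> R) l :
  Rsum (map f (flat_map g l)) = Rsum (map (fun x => Rsum (map f (g x))) l).
Proof. induction l as [|a l IH]; simpl; [reflexivity|]. now rewrite map_app, Rsum_app, IH. Qed.

Lemma Rsum_incl {X : Type} (f : X -> R) S S' :
  (forall x, 0 <= f x) -> NoDup S -> incl S S' -> Rsum (map f S) <= Rsum (map f S').
Proof.
  intros Hf HS. revert S'. induction HS as [|a S Ha HS IH]; intros S' Hi.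
  - now apply Rsum_map_nonneg.
  - destruct (in_split a S') as (l1 & l2 & ->); [apply Hi; now left|].
    rewrite (Rsum_perm (map f (l1 ++ a :: l2)) (map f (a :: l1 ++ l2))).
    2:{ apply Permutation_map, Permutation_sym, Permutation_middle. }
    simpl. apply Rplus_le_compat_l, IH.
    intros b Hb. specialize (Hi b (or_intror Hb)).
    apply in_app_iff in Hi. apply in_app_iff. destruct Hi as [|[->|]]; auto. contradiction.
Qed.

Lemma Rsum_incl_zero {X : Type} (f : X -> R) S S' :
  NoDup S -> NoDup S' -> incl S S' -> (forall x, In x S' -> ~ In x S -> f x = 0) ->
  Rsum (map f S') = Rsum (map f S).
Proof.
  intros HS. revert S'. induction HS as [|a S Ha HS IH]; intros S' HS' Hi Hz.
  - apply Rsum_map_zero. auto.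
  - destruct (in_split a S') as (l1 & l2 & ->); [apply Hi; now left|].
    rewrite (Rsum_perm (map f (l1 ++ a :: l2)) (map f (a :: l1 ++ l2))).
    2:{ apply Permutation_map, Permutation_sym, Permutation_middle. }
    assert (HP : NoDup (a :: l1 ++ l2)).
    { eapply Permutation_NoDup; [apply Permutation_sym, Permutation_middle|exact HS']. }
    inversion HP; subst.
    simpl. f_equal. apply IH; auto.
    + intros b Hb. specialize (Hi b (or_intror Hb)).
      apply in_app_iff in Hi. apply in_app_iff. destruct Hi as [|[->|]]; auto. contradiction.
    + intros x Hx Hn. apply Hz.
      * apply in_app_iff in Hx. apply in_app_iff. simpl. tauto.
      * intros [->|]; contradiction.
Qed.

Lemma Rprod_app (u w : list R) : Rprod (u ++ w) = Rprod u * Rprod w.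
Proof. induction u as [|a u IH]; simpl; [lra|rewrite IH; lra]. Qed.

Lemma Rprod_perm (u w : list R) : Permutation u w -> Rprod u = Rprod w.
Proof. induction 1; simpl; try lra. rewrite IHPermutation; lra. Qed.

Lemma Rprod_map_mult {X : Type} (f g : X -> R) l :
  Rprod (map (fun x => f x * g x) l) = Rprod (map f l) * Rprod (map g l).
Proof. induction l as [|a l IH]; simpl; [lra|rewrite IH; lra]. Qed.

Lemma Rprod_map_ext {X : Type} (f g : X -> R) l :
  (forall x, In x l -> f x = g x) -> Rprod (map f l) = Rprod (map g l).
Proof. intros H. f_equal. now apply map_ext_in. Qed.

Lemma Rprod_map_nonneg {X : Type} (f : X -> R) l :
  (forall x, In x l -> 0 <= f x) -> 0 <= Rprod (map f l).
Proof.
  induction l as [|a l IH]; simpl; intros H; [lra|].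
  apply Rmult_le_pos; [apply H; now left|apply IH; intros; apply H; now right].
Qed.

Lemma Rprod_map_Rabs_le {X : Type} (f : X -> R) M l :
  (forall x, In x l -> Rabs (f x) <= M) -> Rabs (Rprod (map f l)) <= M ^ length l.
Proof.
  induction l as [|a l IH]; simpl; intros H; [rewrite Rabs_R1; lra|].
  rewrite Rabs_mult. apply Rmult_le_compat; try apply Rabs_pos; auto.
Qed.

(** * Unordered sums *)

Lemma has_sum_ext {X : Type} (f g : X -> R) s :
  (forall x, f x = g x) -> has_sum f s -> has_sum g s.
Proof. intros H. now rewrite (functional_extensionality _ _ H). Qed.

Lemma has_sum_unique {X : Type} (f : X -> R) s s' : has_sum f s -> has_sum f s' -> s = s'.
Proof.
  intros H H'. apply Rminus_diag_uniq, NNPP. intros Hn.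
  assert (He : 0 < Rabs (s - s') / 2) by (apply Rabs_pos_lt in Hn; lra).
  destruct (H _ He) as [S0 H0], (H' _ He) as [S0' H0'].
  specialize (H0 (nodup ceq (S0 ++ S0')) (NoDup_nodup _ _)).
  specialize (H0' (nodup ceq (S0 ++ S0')) (NoDup_nodup _ _)).
  assert (I : forall x, In x (S0 ++ S0') -> In x (nodup ceq (S0 ++ S0'))) by (intros; now apply nodup_In).
  assert (I1 := H0 (fun x Hx => I x (in_or_app _ _ _ (or_introl Hx)))).
  assert (I2 := H0' (fun x Hx => I x (in_or_app _ _ _ (or_intror Hx)))).
  revert I1 I2 He. generalize (Rsum (map f (nodup ceq (S0 ++ S0')))). intros r.
  unfold Rabs. repeat destruct Rcase_abs; lra.
Qed.

Lemma has_sum_plus {X : Type} (f g : X -> R) s r :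
  has_sum f s -> has_sum g r -> has_sum (fun x => f x + g x) (s + r).
Proof.
  intros H H' e He. destruct (H (e/2)) as [S0 H0]; [lra|].
  destruct (H' (e/2)) as [S0' H0']; [lra|]. exists (S0 ++ S0'). intros S HS Hi.
  specialize (H0 S HS (fun x Hx => Hi x (in_or_app _ _ _ (or_introl Hx)))).
  specialize (H0' S HS (fun x Hx => Hi x (in_or_app _ _ _ (or_intror Hx)))).
  rewrite Rsum_map_plus. revert H0 H0'.
  unfold Rabs. repeat destruct Rcase_abs; lra.
Qed.

Lemma has_sum_scal {X : Type} (f : X -> R) c s :
  has_sum f s -> has_sum (fun x => c * f x) (c * s).
Proof.
  intros H e He. destruct (H (e / (Rabs c + 1))) as [S0 H0].
  { apply Rdiv_lt_0_compat; [lra|]. pose proof (Rabs_pos c); lra. }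
  exists S0. intros S HS Hi. specialize (H0 S HS Hi).
  rewrite Rsum_map_scal, <- Rmult_minus_distr_l, Rabs_mult.
  pose proof (Rabs_pos c). pose proof (Rabs_pos (Rsum (map f S) - s)).
  apply Rmult_lt_compat_l with (r := Rabs c + 1) in H0; [|lra].
  replace ((Rabs c + 1) * (e / (Rabs c + 1))) with e in H0 by (field; lra). nra.
Qed.

Lemma has_sum_scal1 {X : Type} (f : X -> R) c : has_sum f 1 -> has_sum (fun x => c * f x) c.
Proof. intros H. apply (has_sum_scal f c) in H. now rewrite Rmult_1_r in H. Qed.

Lemma has_sum_minus {X : Type} (f g : X -> R) s r :
  has_sum f s -> has_sum g r -> has_sum (fun x => f x - g x) (s - r).
Proof.
  intros H H'. replace (s - r) with (s + -1 * r) by ring.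
  apply has_sum_ext with (fun x => f x + -1 * g x); [intros; ring|].
  apply has_sum_plus; [exact H|]. now apply has_sum_scal.
Qed.

Lemma has_sum_finite {X : Type} (f : X -> R) S0 :
  NoDup S0 -> (forall x, ~ In x S0 -> f x = 0) -> has_sum f (Rsum (map f S0)).
Proof.
  intros HN Hz e He. exists S0. intros S HS Hi.
  rewrite (Rsum_incl_zero f S0 S); auto. rewrite Rminus_diag, Rabs_R0; lra.
Qed.

Lemma has_sum_zero {X : Type} : has_sum (fun _ : X => 0) 0.
Proof. apply (has_sum_finite (fun _ : X => 0) []); [constructor|reflexivity]. Qed.

Lemma has_sum_single {X : Type} (f : X -> R) a :
  (forall x, x <> a -> f x = 0) -> has_sum f (f a).
Proof.
  intros H. replace (f a) with (Rsum (map f [a])) by (simpl; lra).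
  apply has_sum_finite; [repeat constructor; auto|]. intros x Hx. apply H. intros ->. apply Hx; now left.
Qed.

Lemma has_sum_Rsum {X I : Type} (f : I -> X -> R) (s : I -> R) (l : list I) :
  (forall i, In i l -> has_sum (f i) (s i)) ->
  has_sum (fun x => Rsum (map (fun i => f i x) l)) (Rsum (map s l)).
Proof.
  induction l as [|a l IH]; simpl; intros H; [apply has_sum_zero|].
  apply has_sum_plus; [apply H; now left|apply IH; intros; apply H; now right].
Qed.

Lemma has_sum_partial_le {X : Type} (f : X -> R) s S :
  (forall x, 0 <= f x) -> has_sum f s -> NoDup S -> Rsum (map f S) <= s.
Proof.
  intros Hf H HS. apply le_epsilon. intros e He. destruct (H e He) as [S0 H0].
  specialize (H0 (nodup ceq (S ++ S0)) (NoDup_nodup _ _)).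
  assert (I : forall x, In x (S ++ S0) -> In x (nodup ceq (S ++ S0))) by (intros; now apply nodup_In).
  assert (I1 := H0 (fun x Hx => I x (in_or_app _ _ _ (or_intror Hx)))).
  assert (I2 := Rsum_incl f S _ Hf HS (fun x Hx => I x (in_or_app _ _ _ (or_introl Hx)))).
  revert I1. unfold Rabs. destruct Rcase_abs; lra.
Qed.

(** For nonnegative terms the finite sums grow with the list, so their supremum is the unordered
    sum. Sums are thereby obtained without being computed. *)
Lemma has_sum_bounded {X : Type} (f : X -> R) B :
  (forall x, 0 <= f x) -> (forall S, NoDup S -> Rsum (map f S) <= B) ->
  exists s, has_sum f s /\ s <= B.
Proof.
  intros Hf HB.
  destruct (completeness (fun r => exists S, NoDup S /\ r = Rsum (map f S))) as [s [Hub Hlub]].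
  { exists B. intros r (S & HS & ->). auto. }
  { exists 0, []. split; [constructor|reflexivity]. }
  exists s. split.
  - intros e He. apply NNPP. intros Hn.
    assert (Hle : s <= s - e).
    { apply Hlub. intros r (S & HS & ->). apply Rnot_lt_le. intros Hlt. apply Hn. exists S.
      intros S' HS' Hi. assert (A := Rsum_incl f S S' Hf HS Hi).
      assert (B' := Hub _ (ex_intro _ S' (conj HS' eq_refl))).
      unfold Rabs. destruct Rcase_abs; lra. }
    lra.
  - apply Hlub. intros r (S & HS & ->). auto.
Qed.

Lemma has_sum_nonneg {X : Type} (f : X -> R) s : (forall x, 0 <= f x) -> has_sum f s -> 0 <= s.
Proof. intros Hf H. apply (has_sum_partial_le f s [] Hf H). constructor. Qed.

Lemma has_sum_le {X : Type} (f g : X -> R) s r :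
  (forall x, f x <= g x) -> has_sum f s -> has_sum g r -> s <= r.
Proof.
  intros Hfg Hf Hg. enough (0 <= r - s) by lra.
  eapply has_sum_nonneg; [|apply (has_sum_minus _ _ _ _ Hg Hf)].
  intros x. specialize (Hfg x). simpl. lra.
Qed.

Lemma has_sum_dominated_nonneg {X : Type} (f g : X -> R) r :
  (forall x, 0 <= f x <= g x) -> has_sum g r -> exists s, has_sum f s /\ s <= r.
Proof.
  intros Hfg Hg. apply has_sum_bounded; [apply Hfg|]. intros S HS.
  apply Rle_trans with (Rsum (map g S)).
  - apply Rsum_map_le. intros; apply Hfg.
  - apply has_sum_partial_le; auto. intros x. specialize (Hfg x). lra.
Qed.

(** [f + g] lies between 0 and [2 g], so the nonnegative case gives it a sum, from which the sum of
    [g] is subtracted. *)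
Lemma has_sum_dominated {X : Type} (f g : X -> R) r :
  (forall x, Rabs (f x) <= g x) -> has_sum g r -> exists s, has_sum f s /\ Rabs s <= r.
Proof.
  intros Hfg Hg.
  destruct (has_sum_dominated_nonneg (fun x => f x + g x) (fun x => 2 * g x) (2 * r)) as (s & Hs & Hle).
  { intros x. specialize (Hfg x). revert Hfg. unfold Rabs. destruct Rcase_abs; lra. }
  { now apply has_sum_scal. }
  exists (s - r).
  assert (H : has_sum f (s - r)).
  { apply has_sum_ext with (fun x => f x + g x - g x); [intros; ring|]. now apply has_sum_minus. }
  split; [exact H|]. apply Rabs_le. split; [|lra].
  assert (- r <= s - r); [|lra].
  apply has_sum_le with (2 := has_sum_scal _ (-1) _ Hg) in H.
  - lra.
  - intros x. specialize (Hfg x). revert Hfg. unfold Rabs. destruct Rcase_abs; lra.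
Qed.

(** A finite sum of column totals is a sum over rows of partial row sums, hence at most the sum of
    the row totals. *)
Lemma has_sum_tonelli {X Y : Type} (f : X -> Y -> R) F H s :
  (forall x y, 0 <= f x y) -> (forall x, has_sum (f x) (F x)) ->
  (forall y, has_sum (fun x => f x y) (H y)) -> has_sum F s -> has_sum H s.
Proof.
  (* One inequality suffices: applied to the transposed array, with the sum just found, it gives the
     reverse one. *)
  enough (K : forall (X Y : Type) (f : X -> Y -> R) F H s,
    (forall x y, 0 <= f x y) -> (forall x, has_sum (f x) (F x)) ->
    (forall y, has_sum (fun x => f x y) (H y)) -> has_sum F s ->
    exists s', has_sum H s' /\ s' <= s).
  { intros Hf HF HH Hs. destruct (K _ _ _ _ _ _ Hf HF HH Hs) as (s' & Hs' & Hle).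
    destruct (K _ _ (fun y x => f x y) H F s') as (s2 & Hs2 & Hle2); auto.
    rewrite (has_sum_unique _ _ _ Hs Hs2) in Hle |- *.
    now replace s2 with s' by lra. }
  clear. intros X Y f F H s Hf HF HH Hs. apply has_sum_bounded.
  - intros y. eapply has_sum_nonneg; [|apply HH]. intros; apply Hf.
  - intros S HS. assert (A := has_sum_Rsum (fun y x => f x y) H S (fun y _ => HH y)).
    refine (has_sum_le _ _ _ _ _ A Hs). intros x. now apply has_sum_partial_le.
Qed.

(** The array with entry [f x] at [(x, p x)] has at most one nonzero entry per row, so Tonelli, read
    in either direction, groups the sum along the fibres of [p]. *)
Lemma has_sum_fibres {X Y : Type} (p : X -> Y) (f : X -> R) (H : Y -> R) s :
  (forall x, 0 <= f x) -> (forall y, has_sum (fun x => if ceq (p x) y then f x else 0) (H y)) ->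
  has_sum f s <-> has_sum H s.
Proof.
  intros Hf HH. set (k := fun x y => if ceq (p x) y then f x else 0).
  assert (Hk : forall x y, 0 <= k x y) by (intros; unfold k; destruct ceq; [auto|lra]).
  assert (R1 : forall x, has_sum (k x) (f x)).
  { intros x. replace (f x) with (k x (p x)) by (unfold k; destruct ceq; tauto).
    apply has_sum_single. intros y Hy. unfold k. destruct ceq; congruence. }
  split; intros Hs.
  - now apply has_sum_tonelli with (f := k) (F := f).
  - now apply has_sum_tonelli with (f := fun y x => k x y) (F := H).
Qed.

(** Only the supports have to correspond bijectively, so lists of a wrong length and infeasible
    transitions never need a partner. *)
Lemma has_sum_reindex {X Y : Type} (i : X -> Y) (f : X -> R) (g : Y -> R) s :
  (forall x, 0 <= f x) -> (forall x, f x <> 0 -> g (i x) = f x) ->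
  (forall x x', f x <> 0 -> f x' <> 0 -> i x = i x' -> x = x') ->
  (forall y, g y <> 0 -> exists x, f x <> 0 /\ i x = y) ->
  has_sum f s -> has_sum g s.
Proof.
  intros Hf Hg Hinj Hsur Hs. refine (proj1 (has_sum_fibres i f g s Hf _) Hs).
  intros y. destruct (classic (exists x, f x <> 0 /\ i x = y)) as [(x & Hx & <-)|Hn].
  - rewrite (Hg x Hx).
    replace (f x) with (if ceq (i x) (i x) then f x else 0) by (destruct ceq; tauto).
    apply (has_sum_single (fun x' => if ceq (i x') (i x) then f x' else 0)).
    intros x' Hne. destruct ceq as [e|]; [|reflexivity].
    apply NNPP. intros Hx'. now apply Hne, Hinj.
  - assert (g y = 0) as -> by (apply NNPP; intros A; apply Hn; auto).
    eapply has_sum_ext; [|apply has_sum_zero]. intros x. simpl.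
    destruct ceq as [e|]; [|reflexivity]. apply NNPP. intros A. apply Hn. exists x. split; auto.
Qed.

(** Tonelli with the head as row index; sums over lists thus become accessible to induction on the
    length. *)
Lemma has_sum_cons {X : Type} (f : list X -> R) (F : X -> R) s :
  (forall l, 0 <= f l) -> f [] = 0 -> (forall a, has_sum (fun l => f (a :: l)) (F a)) ->
  has_sum F s -> has_sum f s.
Proof.
  intros Hf H0 HF Hs.
  apply has_sum_tonelli with (f := fun a l => if ceq (hd_error l) (Some a) then f l else 0) (F := F); auto.
  - intros; destruct ceq; auto; lra.
  - intros a. apply has_sum_reindex with (i := cons a) (f := fun l => f (a :: l)); auto.
    + intros l _. simpl. destruct ceq; tauto.
    + intros. congruence.
    + intros l Hl. destruct ceq as [e|]; [|tauto]. destruct l as [|b l]; [discriminate|].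
      simpl in e. injection e as ->. now exists l.
  - intros [|a l].
    + rewrite H0. eapply has_sum_ext; [|apply has_sum_zero]. intros; simpl. now destruct ceq.
    + set (g := fun b => if ceq (hd_error (a :: l)) (Some b) then f (a :: l) else 0).
      assert (f (a :: l) = g a) as -> by (unfold g; simpl; destruct ceq; tauto).
      apply has_sum_single. intros b Hb. unfold g. simpl. destruct ceq; congruence.
Qed.

Lemma sum_f_R0_Rsum (f : nat -> R) N : sum_f_R0 f N = Rsum (map f (seq 0 (S N))).
Proof. induction N as [|N IH]; [simpl; lra|]. rewrite seq_S, map_app, Rsum_app, <- IH. simpl. lra. Qed.

Lemma has_sum_infinite_sum (f : nat -> R) s :
  (forall k, 0 <= f k) -> infinite_sum f s -> has_sum f s.
Proof.
  intros Hf H.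
  assert (E := sum_f_R0_Rsum f).
  assert (U : Un_cv (sum_f_R0 f) s) by (intros e He; destruct (H e He) as [N HN]; exists N; intros; now apply HN).
  assert (G : Un_growing (sum_f_R0 f)) by (intros n; simpl; specialize (Hf (S n)); lra).
  assert (B := growing_ineq _ _ G U).
  intros e He. destruct (U e He) as [N HN]. exists (seq 0 (S N)). intros S HS Hi.
  specialize (HN N (Nat.le_refl _)). unfold Rdist in HN. rewrite E in HN.
  assert (A := Rsum_incl f _ S Hf (seq_NoDup _ _) Hi).
  assert (A' : Rsum (map f S) <= s).
  (* Any finite list of naturals sits in an initial segment, whose sum is at most the limit. *)
  { apply Rle_trans with (2 := B (list_max S)). rewrite E. apply Rsum_incl; auto.
    intros k Hk. apply in_seq. split; [lia|].
    pose proof (proj1 (list_max_le S (list_max S)) (Nat.le_refl _)) as Q.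
    rewrite Forall_forall in Q. specialize (Q k Hk). lia. }
  revert HN. unfold Rabs. repeat destruct Rcase_abs; lra.
Qed.

(** * One-step transition probabilities of the first coordinates *)

Definition fact_prod (b : list nat) : R := Rprod (map (fun k => INR (fact k)) b).

Lemma fact_prod_ge1 b : 1 <= fact_prod b.
Proof.
  unfold fact_prod. induction b as [|a b IH]; simpl; [lra|].
  assert (1 <= INR (fact a)) by (apply (le_INR 1); pose proof (lt_O_fact a); lia). nra.
Qed.

Lemma fact_prod_app b b' : fact_prod (b ++ b') = fact_prod b * fact_prod b'.
Proof. unfold fact_prod. now rewrite map_app, Rprod_app. Qed.

(** The binomial theorem for [(1 + m)^j] divided by [j!]: [a] balls fall into one cell and [j - a]
    into the other [m]. *)
Lemma binomial_fact m j :
  Rsum (map (fun a => / INR (fact a) * (INR m ^ (j - a) / INR (fact (j - a)))) (seq 0 (S j)))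
  = INR (S m) ^ j / INR (fact j).
Proof.
  rewrite S_INR, Rplus_comm, binomial.
  rewrite sum_f_R0_Rsum. unfold Rdiv at 2. rewrite Rmult_comm, <- Rsum_map_scal.
  apply Rsum_map_ext. intros a _. unfold C. rewrite pow1. field.
  repeat split; apply INR_fact_neq_0.
Qed.

(** The multinomial theorem with all variables equal to 1, by induction on the number of cells. *)
Lemma multinomial_sum m j :
  has_sum (fun b => if ((length b =? m) && (list_sum b =? j))%nat%bool then / fact_prod b else 0)
          (INR m ^ j / INR (fact j)).
Proof.
  revert j. induction m as [|m IH]; intros j.
  - replace (INR 0 ^ j / INR (fact j)) with ((fun b => if ((length b =? 0) && (list_sum b =? j))%nat%bool then / fact_prod b else 0) []).
    + apply (has_sum_single (fun b => if ((length b =? 0) && (list_sum b =? j))%nat%bool then / fact_prod b else 0)).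
      intros [|a b] Hb; [congruence|reflexivity].
    + unfold fact_prod. destruct j; simpl; [field|]. unfold Rdiv. ring.
  (* The guard is needed because [j - a] is truncated: a head larger than [j] must contribute
     nothing. *)
  - set (F := fun a => if (a <=? j)%nat then / INR (fact a) * (INR m ^ (j - a) / INR (fact (j - a))) else 0).
    apply has_sum_cons with (F := F).
    + intros b. destruct andb; [|lra]. left. apply Rinv_0_lt_compat. pose proof (fact_prod_ge1 b); lra.
    + reflexivity.
    + intros a. unfold F. destruct (Nat.leb_spec a j).
      * eapply has_sum_ext; [|apply has_sum_scal, IH]. intros b. cbn [length list_sum fold_right].
        replace (S (length b) =? S m)%nat with (length b =? m)%nat by reflexivity.
        replace (a + fold_right Nat.add 0 b =? j)%nat with (list_sum b =? j - a)%nat.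
        2:{ unfold list_sum. destruct (Nat.eqb_spec (fold_right Nat.add 0%nat b) (j - a)); symmetry;
            [apply Nat.eqb_eq|apply Nat.eqb_neq]; lia. }
        destruct andb; [|ring]. unfold fact_prod. simpl. rewrite Rinv_mult. reflexivity.
      * eapply has_sum_ext; [|apply has_sum_zero]. intros b. cbn [length list_sum fold_right].
        assert ((a + fold_right Nat.add 0 b =? j)%nat = false) as -> by (apply Nat.eqb_neq; lia).
        now rewrite Bool.andb_false_r.
    + rewrite <- binomial_fact.
      rewrite (Rsum_map_ext _ F).
      * apply has_sum_finite; [apply seq_NoDup|]. intros a Ha. unfold F.
        destruct (Nat.leb_spec a j); [|reflexivity]. exfalso. apply Ha, in_seq. lia.
      * intros a Ha. apply in_seq in Ha. unfold F. destruct (Nat.leb_spec a j); [reflexivity|lia].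
Qed.

Lemma wbit_le a : (wbit a <= a)%nat.
Proof. destruct a; unfold wbit; simpl; lia. Qed.

(** Inverse of [bvec x] on feasible targets: the state reached from [x] under the arrivals [b]. It
    turns sums over next states into sums over arrivals. *)
Definition shift (x b : list nat) : list nat :=
  map (fun p => (fst p - wbit (fst p) + snd p)%nat) (combine x b).

Lemma shift_length x b : length x = length b -> length (shift x b) = length b.
Proof. intros H. unfold shift. rewrite length_map, length_combine. lia. Qed.

Lemma bvec_length x y : length x = length y -> length (bvec x y) = length x.
Proof. intros H. unfold bvec. rewrite length_map, length_combine. lia. Qed.

Lemma feasible_shift x b : feasible x (shift x b) = true.
Proof.
  revert b. unfold feasible, shift. induction x as [|a x IH]; intros [|c b]; simpl; auto.
  rewrite IH, Bool.andb_true_r. apply Nat.leb_le. pose proof (wbit_le a). lia.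
Qed.

Lemma bvec_shift x b : length x = length b -> bvec x (shift x b) = b.
Proof.
  revert b. unfold bvec, shift. induction x as [|a x IH]; intros [|c b]; simpl; try discriminate; auto.
  intros [= H]. f_equal; auto. pose proof (wbit_le a). lia.
Qed.

Lemma shift_bvec x y : length x = length y -> feasible x y = true -> shift x (bvec x y) = y.
Proof.
  revert y. unfold bvec, shift, feasible. induction x as [|a x IH]; intros [|c y]; simpl; try discriminate; auto.
  intros [= H] Hf. apply andb_prop in Hf. destruct Hf as [H1 H2]. apply Nat.leb_le in H1.
  f_equal; auto. pose proof (wbit_le a). lia.
Qed.

Lemma feasible_app z x z' y : length z = length z' ->
  feasible (z ++ x) (z' ++ y) = (feasible z z' && feasible x y)%bool.
Proof.
  revert z'. unfold feasible. induction z as [|a z IH]; intros [|c z']; simpl; try discriminate; auto.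
  intros [= H]. now rewrite IH, Bool.andb_assoc.
Qed.

Lemma bvec_app z x z' y : length z = length z' -> bvec (z ++ x) (z' ++ y) = bvec z z' ++ bvec x y.
Proof.
  revert z'. unfold bvec. induction z as [|a z IH]; intros [|c z']; simpl; try discriminate; auto.
  intros [= H]. now rewrite IH.
Qed.

(* Probability that [K] balls thrown into [L] bins put exactly [b] into the first [n]. *)
Definition marg (L n K : nat) (b : list nat) : R :=
  if (list_sum b <=? K)%nat
  then INR (fact K) / (fact_prod b * INR (fact (K - list_sum b))) * (/ INR L) ^ K
       * INR (L - n) ^ (K - list_sum b)
  else 0.

(** Chance that one step from [x] puts the first [n] bins in state [z']. It depends on [x] only
    through its first [n] bins and its occupied count, and these are the two things that chaos
    controls. *)
Definition prefix_kernel (L n : nat) (z' x : list nat) : R :=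
  if feasible (firstn n x) z' then marg L n (occ x) (bvec (firstn n x) z') else 0.

Lemma rbb_kernel_nonneg L x y : (1 <= L)%nat -> 0 <= rbb_kernel L x y.
Proof.
  intros HL. unfold rbb_kernel, multinom. destruct (_ && _)%bool; [|lra].
  destruct Nat.eqb; [|lra]. apply Rmult_le_pos.
  - apply Rmult_le_pos; [apply pos_INR|]. left. apply Rinv_0_lt_compat.
    pose proof (fact_prod_ge1 (bvec x y)) as Q. unfold fact_prod in Q. lra.
  - apply pow_le. left. apply Rinv_0_lt_compat, lt_0_INR. lia.
Qed.

(** A next state with prefix [z'] is determined by the arrivals [b] in the other [L - n] bins, which
    must total [K - s]. Its multinomial weight is a constant [c] times [/ fact_prod b], and
    [multinomial_sum] adds these up. *)
Lemma kernel_prefix_sum L n x z' :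
  (1 <= L)%nat -> (n <= L)%nat -> length x = L -> length z' = n ->
  has_sum (fun y => if list_eq_dec Nat.eq_dec (firstn n y) z' then rbb_kernel L x y else 0)
          (prefix_kernel L n z' x).
Proof.
  intros HL Hn Hx Hz. unfold prefix_kernel.
  set (K := occ x). set (z := firstn n x). set (x2 := skipn n x).
  assert (Ex : x = z ++ x2) by (symmetry; apply firstn_skipn).
  assert (Lz : length z = n) by (unfold z; rewrite length_firstn; lia).
  assert (Lx2 : length x2 = (L - n)%nat) by (unfold x2; rewrite length_skipn; lia).
  assert (Lpos : 0 < INR L) by (apply lt_0_INR; lia).
  assert (V : forall y, firstn n y = z' -> exists y2, y = z' ++ y2).
  { intros y <-. exists (skipn n y). symmetry; apply firstn_skipn. }
  assert (W : forall y2, rbb_kernel L x (z' ++ y2) =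
     if ((length y2 =? L - n)%nat && (feasible z z' && feasible x2 y2))%bool
     then multinom L K (bvec z z' ++ bvec x2 y2) else 0).
  { intros y2. unfold rbb_kernel. rewrite Hx, Nat.eqb_refl, length_app, Hz. simpl andb.
    replace (n + length y2 =? L)%nat with (length y2 =? L - n)%nat.
    2:{ destruct (Nat.eqb_spec (length y2) (L - n)); symmetry; [apply Nat.eqb_eq|apply Nat.eqb_neq]; lia. }
    fold K. rewrite Ex, feasible_app, bvec_app by lia. reflexivity. }
  destruct (feasible z z') eqn:Ef.
  2:{ eapply has_sum_ext; [|apply has_sum_zero]. intros y. simpl.
      destruct list_eq_dec as [e|]; [|reflexivity]. destruct (V y e) as [y2 ->].
      rewrite W, Bool.andb_false_r. reflexivity. }
  set (b1 := bvec z z'). unfold marg. set (s := list_sum b1).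
  pose proof (fact_prod_ge1 b1) as P1.
  destruct (Nat.leb_spec s K) as [Hs|Hs].
  2:{ eapply has_sum_ext; [|apply has_sum_zero]. intros y. simpl.
      destruct list_eq_dec as [e|]; [|reflexivity]. destruct (V y e) as [y2 ->].
      rewrite W. destruct (_ && _)%bool; [|reflexivity]. unfold multinom.
      fold b1. rewrite list_sum_app. fold s.
      assert ((s + list_sum (bvec x2 y2) =? K)%nat = false) as -> by (apply Nat.eqb_neq; lia). reflexivity. }
  set (c := INR (fact K) / fact_prod b1 * (/ INR L) ^ K).
  assert (cpos : 0 < c).
  { unfold c. apply Rmult_lt_0_compat.
    - apply Rdiv_lt_0_compat; [apply INR_fact_lt_0|lra].
    - apply pow_lt. now apply Rinv_0_lt_compat. }
  replace (INR (fact K) / (fact_prod b1 * INR (fact (K - s))) * (/ INR L) ^ K * INR (L - n) ^ (K - s))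
    with (c * (INR (L - n) ^ (K - s) / INR (fact (K - s)))).
  2:{ unfold c. field. repeat split; try apply INR_fact_neq_0; lra. }
  assert (M := has_sum_scal _ c _ (multinomial_sum (L - n) (K - s))).
  cbv beta in M.
  set (f := fun b => c * (if ((length b =? L - n) && (list_sum b =? K - s))%nat%bool then / fact_prod b else 0)) in M.
  assert (Nf : forall b, f b <> 0 -> length b = (L - n)%nat /\ list_sum b = (K - s)%nat).
  { intros b Hb. unfold f in Hb. destruct (Nat.eqb_spec (length b) (L - n)), (Nat.eqb_spec (list_sum b) (K - s));
    simpl in Hb; auto; exfalso; apply Hb; ring. }
  assert (Kb : forall b, length b = (L - n)%nat -> rbb_kernel L x (z' ++ shift x2 b) = f b).
  { intros b Hb. rewrite W, feasible_shift, shift_length by lia. rewrite Hb, Nat.eqb_refl. simpl andb.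
    cbv iota. rewrite bvec_shift by lia. unfold multinom, f. fold b1.
    rewrite list_sum_app, Hb, Nat.eqb_refl. fold s.
    replace (s + list_sum b =? K)%nat with (list_sum b =? K - s)%nat.
    2:{ destruct (Nat.eqb_spec (list_sum b) (K - s)); symmetry; [apply Nat.eqb_eq|apply Nat.eqb_neq]; lia. }
    simpl andb. destruct Nat.eqb; [|ring]. fold (fact_prod (b1 ++ b)). rewrite fact_prod_app. unfold c.
    pose proof (fact_prod_ge1 b). field. repeat split; lra. }
  apply has_sum_reindex with (i := fun b => z' ++ shift x2 b) (f := f); [| | | |exact M].
  - intros b. unfold f. destruct andb; [|lra]. pose proof (fact_prod_ge1 b).
    apply Rmult_le_pos; [lra|]. left. apply Rinv_0_lt_compat. lra.
  - intros b Hb. destruct (Nf b Hb) as [Hb1 Hb2]. rewrite Kb by auto.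
    destruct list_eq_dec as [|e]; [reflexivity|]. exfalso. apply e.
    rewrite firstn_app, Hz, Nat.sub_diag, (firstn_all2 z') by lia. apply app_nil_r.
  - intros b b' Hb Hb' E. destruct (Nf b Hb), (Nf b' Hb'). apply app_inv_head in E.
    rewrite <- (bvec_shift x2 b), <- (bvec_shift x2 b'), E by lia. reflexivity.
  - intros y Hy. destruct list_eq_dec as [e|]; [|tauto]. destruct (V y e) as [y2 ->].
    rewrite W in Hy. destruct (Nat.eqb_spec (length y2) (L - n)) as [Hl|]; [|simpl in Hy; tauto].
    destruct (feasible x2 y2) eqn:E2; [|simpl in Hy; tauto].
    assert (Sy : shift x2 (bvec x2 y2) = y2) by (apply shift_bvec; [lia|auto]).
    exists (bvec x2 y2). rewrite Sy. split; [|reflexivity].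
    rewrite <- Kb by (rewrite bvec_length; lia). rewrite Sy, W, Hl, Nat.eqb_refl, E2. exact Hy.
Qed.

(** With the empty prefix every next state counts, and the marginal formula collapses to
    [((1/L) L)^K]. *)
Lemma kernel_sum L x : (1 <= L)%nat -> length x = L -> has_sum (rbb_kernel L x) 1.
Proof.
  intros HL Hx. assert (H := kernel_prefix_sum L 0 x [] HL (Nat.le_0_l _) Hx eq_refl).
  replace (prefix_kernel L 0 [] x) with 1 in H.
  - eapply has_sum_ext; [|exact H]. reflexivity.
  - unfold prefix_kernel, marg, fact_prod. simpl. rewrite !Nat.sub_0_r.
    assert (0 < INR L) by (apply lt_0_INR; lia).
    replace (INR (fact (occ x)) / (1 * INR (fact (occ x))) * (/ INR L) ^ occ x * INR L ^ occ x)
      with ((/ INR L * INR L) ^ occ x).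
    + rewrite Rinv_l, pow1; lra.
    + rewrite Rpow_mult_distr. field. apply INR_fact_neq_0.
Qed.

Lemma prefix_kernel_bounds L n z' x :
  (1 <= L)%nat -> (n <= L)%nat -> length x = L -> length z' = n -> 0 <= prefix_kernel L n z' x <= 1.
Proof.
  intros HL Hn Hx Hz. assert (H := kernel_prefix_sum L n x z' HL Hn Hx Hz). split.
  - eapply has_sum_nonneg; [|exact H]. intros y. simpl. destruct list_eq_dec; [|lra]. now apply rbb_kernel_nonneg.
  - refine (has_sum_le _ _ _ _ _ H (kernel_sum L x HL Hx)).
    intros y. simpl. pose proof (rbb_kernel_nonneg L x y HL). destruct list_eq_dec; lra.
Qed.

(** * The law of the process *)

Lemma in_box x y : In x (box y) <-> Forall2 (fun a b => (a <= b + 1)%nat) x y.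
Proof.
  revert x. induction y as [|b y IH]; intros x; simpl.
  - split; [intros [<-|[]]; constructor|inversion 1; auto].
  - rewrite in_flat_map. split.
    + intros (z & Hz & Hx). apply in_map_iff in Hx. destruct Hx as (i & <- & Hi).
      apply in_seq in Hi. constructor; [lia|now apply IH].
    + intros H. inversion H as [|a b' x' y' Hab Hxy]; subst. exists x'. split; [now apply IH|].
      apply in_map_iff. exists a. split; [reflexivity|]. apply (in_seq (b + 2) 0). lia.
Qed.

Lemma NoDup_box y : NoDup (box y).
Proof.
  induction y as [|b y IH]; [repeat constructor; auto|]. cbn [box].
  induction IH as [|z l Hz Hl IHl]; [constructor|]. cbn [flat_map]. apply NoDup_app.
  - apply FinFun.Injective_map_NoDup; [intros i j; congruence|apply seq_NoDup].
  - exact IHl.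
  - intros x Hx Hx'. apply in_map_iff in Hx. destruct Hx as (i & <- & _).
    apply in_flat_map in Hx'. destruct Hx' as (z' & Hz' & Hi).
    apply in_map_iff in Hi. destruct Hi as (j & [= -> ->] & _). contradiction.
Qed.

Lemma in_box_length x y : In x (box y) -> length x = length y.
Proof. intros H. apply in_box in H. now apply Forall2_length in H. Qed.

Lemma feasible_in_box x y : length x = length y -> feasible x y = true -> In x (box y).
Proof.
  intros Hl Hf. apply in_box. revert y Hl Hf. unfold feasible.
  induction x as [|a x IH]; intros [|b y]; simpl; try discriminate; [constructor|].
  intros [= Hl] Hf. apply andb_prop in Hf. destruct Hf as [H1 H2]. constructor; [|auto].
  apply Nat.leb_le in H1. unfold wbit in H1. destruct Nat.eqb; lia.
Qed.

Lemma rbb_kernel_support L x y : rbb_kernel L x y <> 0 -> length x = L /\ length y = L /\ In x (box y).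
Proof.
  unfold rbb_kernel. destruct (Nat.eqb_spec (length x) L), (Nat.eqb_spec (length y) L); simpl; try tauto.
  destruct (feasible x y) eqn:E; [|tauto]. intros _. repeat split; auto. apply feasible_in_box; congruence.
Qed.

(** * Exchangeability is preserved by the dynamics *)

Lemma combine_fst_snd (ps : list (nat * nat)) : combine (map fst ps) (map snd ps) = ps.
Proof. induction ps as [|[a b] ps IH]; simpl; congruence. Qed.

Lemma map_fst_combine (x y : list nat) : length x = length y -> map fst (combine x y) = x.
Proof. revert y. induction x as [|a x IH]; intros [|b y]; simpl; try discriminate; auto. intros [= H]. f_equal; auto. Qed.

Lemma map_snd_combine (x y : list nat) : length x = length y -> map snd (combine x y) = y.
Proof. revert y. induction x as [|a x IH]; intros [|b y]; simpl; try discriminate; auto. intros [= H]. f_equal; auto. Qed.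

Lemma list_sum_perm u w : Permutation u w -> list_sum u = list_sum w.
Proof. unfold list_sum. induction 1; simpl; lia. Qed.

Lemma forallb_perm {X : Type} (p : X -> bool) u w : Permutation u w -> forallb p u = forallb p w.
Proof.
  induction 1; simpl; try congruence. now rewrite !Bool.andb_assoc, (Bool.andb_comm (p x)).
Qed.

(** The kernel sees only the multiset of pairs (old load, new load). Stated on a list of pairs, a
    simultaneous permutation of both states is an ordinary one. *)
Lemma rbb_kernel_perm L ps ps' : Permutation ps ps' ->
  rbb_kernel L (map fst ps) (map snd ps) = rbb_kernel L (map fst ps') (map snd ps').
Proof.
  intros HP. unfold rbb_kernel, multinom, feasible, bvec, occ.
  rewrite !combine_fst_snd, !length_map, (Permutation_length HP), (forallb_perm _ _ _ HP).
  rewrite (list_sum_perm _ _ (Permutation_map wbit (Permutation_map fst HP))).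
  set (h := fun p : nat * nat => (snd p + wbit (fst p) - fst p)%nat).
  rewrite (list_sum_perm _ _ (Permutation_map h HP)).
  rewrite (Rprod_perm _ _ (Permutation_map (fun k => INR (fact k)) (Permutation_map h HP))).
  reflexivity.
Qed.

Lemma box_sum_cons (f : list nat -> R) a y :
  Rsum (map f (box (a :: y))) =
  Rsum (map (fun i => Rsum (map (fun z => f (i :: z)) (box y))) (seq 0 (a + 2))).
Proof.
  cbn [box]. rewrite Rsum_flat_map, <- Rsum_swap. apply Rsum_map_ext.
  intros z _. now rewrite map_map.
Qed.

(** Quantifying over every symmetric [H] lets the induction absorb a fixed head pair into [H]; a
    transposition of the first two entries is then an exchange of two finite sums. *)
Lemma box_sum_perm y y' : Permutation y y' -> forall H : list (nat * nat) -> R,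
  (forall ps ps', Permutation ps ps' -> H ps = H ps') ->
  Rsum (map (fun x => H (combine x y)) (box y)) = Rsum (map (fun x => H (combine x y')) (box y')).
Proof.
  induction 1 as [|a y y' HP IH|a b y|y y' y'' HP1 IH1 HP2 IH2]; intros H HH.
  - reflexivity.
  - rewrite !box_sum_cons. apply Rsum_map_ext. intros i _. apply (IH (fun ps => H ((i, a) :: ps))).
    intros ps ps' Hps. apply HH. now constructor.
  - rewrite !box_sum_cons.
    rewrite (Rsum_map_ext _ (fun i => Rsum (map (fun j =>
      Rsum (map (fun z => H ((i, b) :: (j, a) :: combine z y)) (box y))) (seq 0 (a + 2))))).
    2:{ intros i _. rewrite box_sum_cons. reflexivity. }
    rewrite Rsum_swap. apply Rsum_map_ext. intros j _. rewrite box_sum_cons.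
    apply Rsum_map_ext. intros i _. apply Rsum_map_ext. intros z _. apply HH. constructor.
  - rewrite (IH1 H HH). now apply IH2.
Qed.

Lemma rbb_law_perm L p :
  (forall x y, Permutation x y -> p x = p y) ->
  forall t x y, Permutation x y -> rbb_law L p t x = rbb_law L p t y.
Proof.
  intros Hp t. induction t as [|t IH]; intros y y' HP; [now apply Hp|].
  cbn [rbb_law].
  (* The summand is symmetric in the pairs: the law by induction, the kernel by
     [rbb_kernel_perm]. *)
  set (H := fun ps => rbb_law L p t (map fst ps) * rbb_kernel L (map fst ps) (map snd ps)).
  assert (E : forall y, Rsum (map (fun x => rbb_law L p t x * rbb_kernel L x y) (box y))
               = Rsum (map (fun x => H (combine x y)) (box y))).
  { intros w. apply Rsum_map_ext. intros x Hx. unfold H. apply in_box_length in Hx.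
    now rewrite map_fst_combine, map_snd_combine. }
  rewrite !E. apply box_sum_perm; [exact HP|]. intros ps ps' Hps. unfold H.
  rewrite (rbb_kernel_perm _ _ _ Hps). f_equal. apply IH. now apply Permutation_map.
Qed.

(** Push-forward of the mass [f] by one transition, kept only on states with prefix [z]. With
    [n = 0] and [z = []] it is the full transition. *)
Definition step (L n : nat) (z : list nat) (f : list nat -> R) (y : list nat) : R :=
  if list_eq_dec Nat.eq_dec (firstn n y) z
  then Rsum (map (fun x => f x * rbb_kernel L x y) (box y)) else 0.

Lemma step_nonneg L n z f y : (1 <= L)%nat -> (forall x, 0 <= f x) -> 0 <= step L n z f y.
Proof.
  intros HL Hf. unfold step. destruct list_eq_dec; [|lra]. apply Rsum_map_nonneg.
  intros x _. apply Rmult_le_pos; [auto|now apply rbb_kernel_nonneg].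
Qed.

Lemma step_support L n z f y : step L n z f y <> 0 -> length y = L /\ firstn n y = z.
Proof.
  unfold step. destruct list_eq_dec; [|tauto]. intros H. split; [|auto]. apply NNPP. intros Hn.
  apply H. apply Rsum_map_zero. intros x _.
  assert (rbb_kernel L x y = 0) as ->; [|ring]. apply NNPP. intros HK.
  now destruct (rbb_kernel_support _ _ _ HK).
Qed.

Lemma column_sum L f y : has_sum (fun x => f x * rbb_kernel L x y)
  (Rsum (map (fun x => f x * rbb_kernel L x y) (box y))).
Proof.
  apply has_sum_finite; [apply NoDup_box|]. intros x Hx.
  assert (rbb_kernel L x y = 0) as ->; [|ring]. apply NNPP. intros HK.
  now destruct (rbb_kernel_support _ _ _ HK).
Qed.

(** Tonelli on pairs (old state, new state): [kernel_prefix_sum] gives the row sums, and the column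
    sums are finite. *)
Lemma step_sum L n z f s :
  (1 <= L)%nat -> (n <= L)%nat -> length z = n -> (forall x, 0 <= f x) ->
  (forall x, f x <> 0 -> length x = L) ->
  has_sum (fun x => f x * prefix_kernel L n z x) s -> has_sum (step L n z f) s.
Proof.
  intros HL Hn Hz Hf Hs H.
  apply has_sum_tonelli with
    (f := fun x y => if list_eq_dec Nat.eq_dec (firstn n y) z then f x * rbb_kernel L x y else 0)
    (F := fun x => f x * prefix_kernel L n z x); auto.
  - intros x y. destruct list_eq_dec; [|lra]. apply Rmult_le_pos; [auto|now apply rbb_kernel_nonneg].
  - intros x. destruct (Req_dec (f x) 0) as [E|E].
    + rewrite E, Rmult_0_l. eapply has_sum_ext; [|apply has_sum_zero]. intros y. simpl. destruct list_eq_dec; ring.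
    + eapply has_sum_ext; [|apply has_sum_scal, kernel_prefix_sum]; auto.
      intros y. cbv beta. destruct list_eq_dec; ring.
  - intros y. unfold step. destruct list_eq_dec; [apply column_sum|apply has_sum_zero].
Qed.

Lemma step_total L f s :
  (1 <= L)%nat -> (forall x, 0 <= f x) -> (forall x, f x <> 0 -> length x = L) ->
  has_sum f s -> has_sum (step L 0 [] f) s.
Proof.
  intros HL Hf Hs H. apply step_sum; auto; [lia|]. eapply has_sum_ext; [|exact H].
  intros x. cbv beta. destruct (Req_dec (f x) 0) as [->|E]; [ring|].
  replace (prefix_kernel L 0 [] x) with 1; [ring|].
  apply has_sum_unique with (1 := kernel_sum L x HL (Hs x E)).
  exact (kernel_prefix_sum L 0 x [] HL (Nat.le_0_l _) (Hs x E) eq_refl).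
Qed.

Lemma rbb_law_step L p t : rbb_law L p (S t) = step L 0 [] (rbb_law L p t).
Proof. reflexivity. Qed.

Lemma rbb_law_prob L p t :
  (1 <= L)%nat -> (forall x, 0 <= p x) -> (forall x, length x <> L -> p x = 0) -> has_sum p 1 ->
  (forall x, 0 <= rbb_law L p t x) /\ (forall x, rbb_law L p t x <> 0 -> length x = L) /\
  has_sum (rbb_law L p t) 1.
Proof.
  intros HL Hp Hs H1. induction t as [|t (I1 & I2 & I3)].
  - repeat split; auto. intros x Hx. apply NNPP. intros Hn. now apply Hx, Hs.
  - rewrite rbb_law_step. repeat split.
    + intros x. now apply step_nonneg.
    + intros x Hx. now apply step_support in Hx.
    + now apply step_total.
Qed.

(** * Law of large numbers for the number of occupied bins *)

Definition transp (i j k : nat) : nat :=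
  if Nat.eqb k i then j else if Nat.eqb k j then i else k.

Definition swap (i j : nat) (x : list nat) : list nat :=
  map (fun k => nth (transp i j k) x 0%nat) (seq 0 (length x)).

Lemma transp_lt i j k n : (i < n)%nat -> (j < n)%nat -> (k < n)%nat -> (transp i j k < n)%nat.
Proof. intros. unfold transp. destruct (Nat.eqb k i), (Nat.eqb k j); lia. Qed.

Lemma transp_invol i j k : transp i j (transp i j k) = k.
Proof.
  unfold transp. destruct (Nat.eqb_spec k i) as [->|Hi].
  - rewrite Nat.eqb_refl. now destruct (Nat.eqb_spec j i).
  - destruct (Nat.eqb_spec k j) as [->|Hj]; [now rewrite Nat.eqb_refl|].
    destruct (Nat.eqb_spec k i), (Nat.eqb_spec k j); congruence.
Qed.

Lemma transp_l i j : transp i j i = j.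
Proof. unfold transp. now rewrite Nat.eqb_refl. Qed.

Lemma transp_other i j k : k <> i -> k <> j -> transp i j k = k.
Proof. intros. unfold transp. now destruct (Nat.eqb_spec k i), (Nat.eqb_spec k j). Qed.

Lemma swap_length i j x : length (swap i j x) = length x.
Proof. unfold swap. now rewrite length_map, length_seq. Qed.

Lemma nth_swap i j x k : (k < length x)%nat -> nth k (swap i j x) 0%nat = nth (transp i j k) x 0%nat.
Proof.
  intros H. unfold swap.
  rewrite (nth_indep _ 0%nat (nth (transp i j 0) x 0%nat)) by (now rewrite length_map, length_seq).
  rewrite (map_nth (fun k => nth (transp i j k) x 0%nat)), seq_nth by exact H. reflexivity.
Qed.

Lemma swap_invol i j x : (i < length x)%nat -> (j < length x)%nat -> swap i j (swap i j x) = x.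
Proof.
  intros Hi Hj. apply nth_ext with 0%nat 0%nat; [now rewrite !swap_length|].
  intros k Hk. rewrite !swap_length in Hk.
  rewrite nth_swap by now rewrite swap_length.
  rewrite nth_swap by now apply transp_lt. now rewrite transp_invol.
Qed.

Lemma swap_perm i j x : (i < length x)%nat -> (j < length x)%nat -> Permutation x (swap i j x).
Proof.
  intros Hi Hj. apply (Permutation_nth x (swap i j x) 0%nat). split; [apply swap_length|].
  exists (transp i j). repeat split.
  - intros k Hk. now apply transp_lt.
  - intros k k' _ _ E. rewrite <- (transp_invol i j k), E. apply transp_invol.
  - intros k Hk. now apply nth_swap.
Qed.

Definition empty (k : nat) : R := if Nat.eqb k 0 then 1 else 0.

Lemma empty_sq k : empty k * empty k = empty k.
Proof. unfold empty. destruct Nat.eqb; lra. Qed.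

Lemma empty_nonneg k : 0 <= empty k.
Proof. unfold empty. destruct Nat.eqb; lra. Qed.

Lemma occ_empty x :
  INR (occ x) = INR (length x) - Rsum (map (fun i => empty (nth i x 0%nat)) (seq 0 (length x))).
Proof.
  unfold occ, list_sum. induction x as [|a x IH]; [simpl; lra|].
  cbn [map fold_right length seq nth Rsum]. rewrite <- seq_shift, map_map.
  rewrite plus_INR, IH, S_INR. unfold wbit, empty, Rsum. destruct Nat.eqb; simpl; lra.
Qed.

Section ExchangeableLaw.
Variables (L : nat) (q : list nat -> R).
Hypothesis q_nonneg : forall x, 0 <= q x.
Hypothesis q_support : forall x, q x <> 0 -> length x = L.
Hypothesis q_perm : forall x y, Permutation x y -> q x = q y.

(** [swap i j] is an involution of the support of [q] that leaves [q] invariant. *)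
Lemma has_sum_swap h i j s : (forall x, 0 <= h x) -> (i < L)%nat -> (j < L)%nat ->
  has_sum (fun x => q x * h x) s -> has_sum (fun x => q x * h (swap i j x)) s.
Proof.
  intros Hh Hi Hj. apply has_sum_reindex with (i := swap i j).
  - intros x. now apply Rmult_le_pos.
  - intros x Hx. assert (length x = L) by (apply q_support; intros E; apply Hx; rewrite E; ring).
    rewrite swap_invol by lia. f_equal. symmetry. apply q_perm, swap_perm; lia.
  - intros x x' Hx Hx' E.
    assert (length x = L) by (apply q_support; intros F; apply Hx; rewrite F; ring).
    assert (length x' = L) by (apply q_support; intros F; apply Hx'; rewrite F; ring).
    rewrite <- (swap_invol i j x), E by lia. apply swap_invol; lia.
  - intros y Hy. assert (length y = L) by (apply q_support; intros F; apply Hy; rewrite F; ring).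
    exists (swap i j y). rewrite swap_invol by lia. split; [|reflexivity].
    rewrite <- (q_perm y) by (apply swap_perm; lia). exact Hy.
Qed.

Lemma empty_mean A i : (i < L)%nat ->
  has_sum (fun x => if list_eq_dec Nat.eq_dec (firstn 1 x) [0%nat] then q x else 0) A ->
  has_sum (fun x => q x * empty (nth i x 0%nat)) A.
Proof.
  intros Hi H.
  assert (H0 : has_sum (fun x => q x * empty (nth 0 x 0%nat)) A).
  { eapply has_sum_ext; [|exact H]. intros x. cbv beta.
    destruct (Req_dec (q x) 0) as [->|E]; [destruct list_eq_dec; ring|]. apply q_support in E.
    destruct x as [|a x]; [simpl in E; lia|]. unfold empty. cbn [firstn nth].
    destruct list_eq_dec as [e|e], (Nat.eqb_spec a 0); subst; try ring; congruence. }
  apply (has_sum_swap (fun x => empty (nth 0 x 0%nat)) 0 i) in H0; [|intros; apply empty_nonneg|lia|auto].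
  eapply has_sum_ext; [|exact H0]. intros x. cbv beta.
  destruct (Req_dec (q x) 0) as [->|E]; [ring|]. apply q_support in E.
  rewrite nth_swap by lia. reflexivity.
Qed.

(** Two transpositions carry any pair of distinct bins to the first two. *)
Lemma empty_mean2 B i j : (i < L)%nat -> (j < L)%nat -> i <> j ->
  has_sum (fun x => if list_eq_dec Nat.eq_dec (firstn 2 x) [0%nat; 0%nat] then q x else 0) B ->
  has_sum (fun x => q x * (empty (nth i x 0%nat) * empty (nth j x 0%nat))) B.
Proof.
  intros Hi Hj Hij H.
  assert (H0 : has_sum (fun x => q x * (empty (nth 0 x 0%nat) * empty (nth 1 x 0%nat))) B).
  { eapply has_sum_ext; [|exact H]. intros x. cbv beta.
    destruct (Req_dec (q x) 0) as [->|E]; [destruct list_eq_dec; ring|]. apply q_support in E.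
    destruct x as [|a [|b x]]; [simpl in E; lia..|]. unfold empty. cbn [firstn nth].
    destruct list_eq_dec as [e|e], (Nat.eqb_spec a 0), (Nat.eqb_spec b 0); subst; try ring; congruence. }
  (* The exchange of 1 and [j] comes first and must fix coordinate 0, hence [j <> 0]; the case
     [j = 0] follows by symmetry of the product. *)
  assert (K : forall i j, (i < L)%nat -> (j < L)%nat -> i <> j -> j <> 0%nat ->
     has_sum (fun x => q x * (empty (nth i x 0%nat) * empty (nth j x 0%nat))) B).
  { clear i j Hi Hj Hij. intros i j Hi Hj Hij Hj0.
    assert (P : forall i j x, 0 <= empty (nth i x 0%nat) * empty (nth j x 0%nat))
      by (intros; apply Rmult_le_pos; apply empty_nonneg).
    apply (has_sum_swap (fun x => empty (nth 0 x 0%nat) * empty (nth 1 x 0%nat)) 1 j) in H0; [|intros; apply P|lia|auto].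
    assert (H1 : has_sum (fun x => q x * (empty (nth 0 x 0%nat) * empty (nth j x 0%nat))) B).
    { eapply has_sum_ext; [|exact H0]. intros x. cbv beta.
      destruct (Req_dec (q x) 0) as [->|E]; [ring|]. apply q_support in E.
      now rewrite !nth_swap, transp_l, transp_other by lia. }
    apply (has_sum_swap (fun x => empty (nth 0 x 0%nat) * empty (nth j x 0%nat)) 0 i) in H1; [|intros; apply P|lia|auto].
    eapply has_sum_ext; [|exact H1]. intros x. cbv beta.
    destruct (Req_dec (q x) 0) as [->|E]; [ring|]. apply q_support in E.
    now rewrite !nth_swap, transp_l, transp_other by lia. }
  destruct (Nat.eq_dec j 0) as [->|Hj0]; [|now apply K].
  eapply has_sum_ext; [|apply (K 0%nat i); auto]. intros x. cbv beta. ring.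
Qed.

(** With [E_i] the indicator that bin [i] is empty, [K/L - (1 - a)] equals [a] minus the average of
    the [E_i]. In the square, the [L] diagonal terms have mean [A] because [E_i^2 = E_i], and the
    [L (L - 1)] mixed ones have mean [B]. *)
Lemma occ_second_moment A B a : (2 <= L)%nat -> has_sum q 1 ->
  has_sum (fun x => if list_eq_dec Nat.eq_dec (firstn 1 x) [0%nat] then q x else 0) A ->
  has_sum (fun x => if list_eq_dec Nat.eq_dec (firstn 2 x) [0%nat; 0%nat] then q x else 0) B ->
  has_sum (fun x => q x * (INR (occ x) / INR L - (1 - a)) ^ 2)
          (A * / INR L + B * (1 - / INR L) - 2 * a * A + a ^ 2).
Proof.
  intros HL H1 HA HB. assert (Lpos : 0 < INR L) by (apply lt_0_INR; lia).
  set (I := fun i (x : list nat) => empty (nth i x 0%nat)).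
  assert (S1 := has_sum_Rsum (fun i x => q x * I i x) (fun _ => A) (seq 0 L)
     (fun i Hi => empty_mean A i (proj2 (proj1 (in_seq L 0 i) Hi)) HA)).
  assert (E2 : forall i j, In i (seq 0 L) -> In j (seq 0 L) ->
    has_sum (fun x => q x * (I i x * I j x)) (if Nat.eqb j i then A else B)).
  { intros i j Hi Hj. apply in_seq in Hi, Hj. unfold I. destruct (Nat.eqb_spec j i) as [->|Hn].
    - eapply has_sum_ext; [|exact (empty_mean A i (proj2 Hi) HA)].
      intros x. cbv beta. now rewrite empty_sq.
    - apply empty_mean2; auto; lia. }
  assert (S2 := has_sum_Rsum (fun i x => Rsum (map (fun j => q x * (I i x * I j x)) (seq 0 L)))
     (fun i => Rsum (map (fun j => if Nat.eqb j i then A else B) (seq 0 L))) (seq 0 L)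
     (fun i Hi => has_sum_Rsum (fun j x => q x * (I i x * I j x))
        (fun j => if Nat.eqb j i then A else B) (seq 0 L) (fun j Hj => E2 i j Hi Hj))).
  rewrite Rsum_map_const, length_seq in S1.
  rewrite (Rsum_map_ext _ (fun _ => INR L * B + (A - B))) in S2.
  2:{ intros i Hi.
      rewrite (Rsum_map_ext _ (fun j => B + (if Nat.eqb j i then A - B else 0))).
      2:{ intros j _. destruct Nat.eqb; ring. }
      rewrite Rsum_map_plus, Rsum_map_const, length_seq. f_equal.
      rewrite (Rsum_incl_zero _ [i]).
      - simpl. rewrite Nat.eqb_refl. ring.
      - repeat constructor; auto.
      - apply seq_NoDup.
      - intros j [<-|[]]. exact Hi.
      - intros j _ Hj. destruct (Nat.eqb_spec j i); [|reflexivity]. exfalso. apply Hj. now left. }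
  rewrite Rsum_map_const, length_seq in S2.
  apply (has_sum_scal _ (/ INR L ^ 2)) in S2. apply (has_sum_scal _ (- 2 * a / INR L)) in S1.
  apply (has_sum_scal _ (a ^ 2)) in H1.
  replace (A * / INR L + B * (1 - / INR L) - 2 * a * A + a ^ 2)
    with (/ INR L ^ 2 * (INR L * (INR L * B + (A - B))) + (- 2 * a / INR L * (INR L * A) + a ^ 2 * 1))
    by (field; lra).
  eapply has_sum_ext; [|exact (has_sum_plus _ _ _ _ S2 (has_sum_plus _ _ _ _ S1 H1))].
  intros x. cbv beta. destruct (Req_dec (q x) 0) as [->|E].
  - rewrite (Rsum_map_zero _ (seq 0 L)).
    2:{ intros i _. apply Rsum_map_zero. intros; ring. }
    rewrite (Rsum_map_zero _ (seq 0 L)) by (intros; ring). ring.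
  - apply q_support in E. rewrite occ_empty, E.
    change (map (fun i => empty (nth i x 0%nat)) (seq 0 L)) with (map (fun i => I i x) (seq 0 L)).
    set (Z := Rsum (map (fun i => I i x) (seq 0 L))).
    rewrite Rsum_map_scal. fold Z.
    rewrite (Rsum_map_ext _ (fun i => (q x * Z) * I i x)).
    2:{ intros i _. rewrite Rsum_map_scal. rewrite Rsum_map_scal. fold Z. ring. }
    rewrite Rsum_map_scal. fold Z. field. lra.
Qed.
End ExchangeableLaw.

Lemma Un_cv_const c : Un_cv (fun _ => c) c.
Proof. intros e He. exists 0%nat. intros. unfold Rdist. rewrite Rminus_diag, Rabs_R0. exact He. Qed.

Lemma Un_cv_inv_INR : Un_cv (fun L => / INR L) 0.
Proof.
  intros e He. destruct (archimed_cor1 e He) as (N & H1 & H2). exists N. intros n Hn.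
  unfold Rdist. rewrite Rminus_0_r.
  assert (0 < INR N) by (apply lt_0_INR; lia).
  assert (INR N <= INR n) by (apply le_INR; lia).
  rewrite Rabs_pos_eq by (left; apply Rinv_0_lt_compat; lra).
  apply Rle_lt_trans with (2 := H1). apply Rinv_le_contravar; lra.
Qed.

Lemma Un_cv_eventually u w l N : (forall n, (N <= n)%nat -> u n = w n) -> Un_cv u l -> Un_cv w l.
Proof.
  intros H Hu e He. destruct (Hu e He) as [N' HN]. exists (N + N')%nat. intros n Hn.
  rewrite <- H by lia. apply HN. lia.
Qed.

Lemma Un_cv_limit_eq u l l' : l = l' -> Un_cv u l -> Un_cv u l'.
Proof. now intros ->. Qed.

(* The constraints on [L] exclude the finitely many [L] for which prefixes of length [n] do not exist. *)
Definition mass_limit (n : nat) (f : nat -> list nat -> R) (c : R) : Prop :=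
  exists m : nat -> R,
    (forall L, (1 <= L)%nat -> (n <= L)%nat -> has_sum (f L) (m L)) /\ Un_cv m c.

Definition restrict (n : nat) (z : list nat) (q : list nat -> R) (x : list nat) : R :=
  if list_eq_dec Nat.eq_dec (firstn n x) z then q x else 0.

(* With exchangeability, asymptotic independence of two bins suffices for a vanishing variance. *)
Lemma occ_lln (q : nat -> list nat -> R) a :
  (forall L, (1 <= L)%nat -> (forall x, 0 <= q L x) /\ (forall x, q L x <> 0 -> length x = L) /\ has_sum (q L) 1) ->
  (forall L x y, (1 <= L)%nat -> Permutation x y -> q L x = q L y) ->
  mass_limit 1 (fun L => restrict 1 [0%nat] (q L)) a ->
  mass_limit 2 (fun L => restrict 2 [0%nat; 0%nat] (q L)) (a * a) ->
  exists D : nat -> R,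
    (forall L, (2 <= L)%nat -> has_sum (fun x => q L x * (INR (occ x) / INR L - (1 - a)) ^ 2) (D L)) /\
    Un_cv D 0.
Proof.
  intros Hq Hp (A & HA & LA) (B & HB & LB).
  exists (fun L => A L * / INR L + B L * (1 - / INR L) - 2 * a * A L + a ^ 2). split.
  - intros L HL. destruct (Hq L) as (Q1 & Q2 & Q3); [lia|].
    apply occ_second_moment; auto; [intros; apply Hp; auto; lia|apply HA; lia|apply HB; lia].
  (* The limit is [a^2 - 2 a^2 + a^2]: it vanishes because the two-bin limit is the square of the
     one-bin limit. *)
  - apply Un_cv_limit_eq with (a * 0 + (a * a) * (1 - 0) - (2 * a) * a + a ^ 2); [ring|].
    repeat first [apply CV_minus | apply CV_plus | apply CV_mult | apply Un_cv_const
      | apply Un_cv_inv_INR | exact LA | exact LB].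
Qed.

(** * Poisson approximation of a transition *)

Lemma Rabs_mult_sub_le a b a' b' : 0 <= a <= 1 -> 0 <= b' <= 1 ->
  Rabs (a * b - a' * b') <= Rabs (a - a') + Rabs (b - b').
Proof.
  intros Ha Hb. replace (a * b - a' * b') with ((a - a') * b' + a * (b - b')) by ring.
  eapply Rle_trans; [apply Rabs_triang|]. rewrite !Rabs_mult.
  rewrite (Rabs_pos_eq a), (Rabs_pos_eq b') by lra.
  pose proof (Rabs_pos (a - a')). pose proof (Rabs_pos (b - b')). nra.
Qed.

Lemma pow_unit a j : 0 <= a <= 1 -> 0 <= a ^ j <= 1.
Proof. intros H. split; [apply pow_le; lra|]. rewrite <- (pow1 j). apply pow_incr. lra. Qed.

Lemma pow_lipschitz a b j : 0 <= a <= 1 -> 0 <= b <= 1 ->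
  Rabs (a ^ j - b ^ j) <= INR j * Rabs (a - b).
Proof.
  intros Ha Hb. induction j as [|j IH].
  - simpl. rewrite Rminus_diag, Rabs_R0. lra.
  - rewrite S_INR. simpl pow.
    eapply Rle_trans; [apply Rabs_mult_sub_le; [lra|now apply pow_unit]|]. lra.
Qed.

Lemma exp_opp_lipschitz x y : 0 <= x -> 0 <= y -> Rabs (exp (- x) - exp (- y)) <= Rabs (x - y).
Proof.
  enough (K : forall x y, 0 <= x -> x <= y -> Rabs (exp (- x) - exp (- y)) <= Rabs (x - y)).
  { intros Hx Hy. destruct (Rle_dec x y); [now apply K|].
    rewrite (Rabs_minus_sym (exp _)), (Rabs_minus_sym x). apply K; lra. }
  clear. intros x y Hx Hy.
  assert (exp (- x) <= 1) by (rewrite <- exp_0; destruct (Req_dec x 0) as [->|]; [rewrite Ropp_0; lra|left; apply exp_increasing; lra]).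
  assert (E : exp (- y) = exp (- x) * exp (- (y - x))) by (rewrite <- exp_plus; f_equal; ring).
  pose proof (exp_pos (- x)). pose proof (exp_ineq1_le (- (y - x))).
  assert (exp (- (y - x)) <= 1) by (rewrite <- exp_0; destruct (Req_dec (y - x) 0) as [->|]; [rewrite Ropp_0; lra|left; apply exp_increasing; lra]).
  rewrite E, (Rabs_left1 (x - y)) by lra. rewrite Rabs_pos_eq; nra.
Qed.

(** From [exp v >= 1 + v] follows [exp (- v) <= 1 / (1 + v) <= 1 - v + v^2]; the other side is the
    tangent bound. *)
Lemma exp_opp_quadratic v : 0 <= v -> Rabs ((1 - v) - exp (- v)) <= v ^ 2.
Proof.
  intros Hv. pose proof (exp_ineq1_le (- v)). pose proof (exp_ineq1_le v).
  assert (E : exp (- v) * exp v = 1) by (rewrite <- exp_plus, Rplus_opp_l; apply exp_0).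
  pose proof (exp_pos (- v)).
  rewrite Rabs_left1 by lra. simpl. nra.
Qed.

Lemma pow_exp x j : exp x ^ j = exp (INR j * x).
Proof.
  induction j as [|j IH]; [simpl; now rewrite Rmult_0_l, exp_0|].
  simpl pow. rewrite IH, <- exp_plus, S_INR. f_equal. ring.
Qed.

(** Falling factorial [K (K - 1) ... (K - s + 1)]. Truncated subtraction makes it 0 for [s > K],
    which absorbs the guard of [marg]. *)
Fixpoint falling (K s : nat) : R :=
  match s with O => 1 | S s' => falling K s' * INR (K - s') end.

Lemma falling_fact K s : (s <= K)%nat -> INR (fact K) = falling K s * INR (fact (K - s)).
Proof.
  induction s as [|s IH]; intros H; [simpl; rewrite Nat.sub_0_r; ring|].
  rewrite IH by lia. cbn [falling]. replace (K - s)%nat with (S (K - S s)) by lia.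
  rewrite fact_simpl, mult_INR. ring.
Qed.

Lemma falling_gt K s : (K < s)%nat -> falling K s = 0.
Proof.
  induction s as [|s IH]; intros H; [lia|]. cbn [falling].
  destruct (Nat.eq_dec K s) as [->|]; [rewrite Nat.sub_diag; simpl; ring|]. rewrite IH by lia. ring.
Qed.

Lemma INR_sub_close K s : 0 <= INR K - INR (K - s) <= INR s.
Proof.
  destruct (Nat.le_ge_cases s K) as [H|H].
  - rewrite minus_INR by auto. pose proof (pos_INR s). lra.
  - replace (K - s)%nat with 0%nat by lia. apply le_INR in H. pose proof (pos_INR K). simpl. lra.
Qed.

Lemma INR_ratio_unit L K : (1 <= L)%nat -> (K <= L)%nat -> 0 <= INR K / INR L <= 1.
Proof.
  intros HL HK. assert (0 < INR L) by (apply lt_0_INR; lia). apply le_INR in HK.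
  pose proof (pos_INR K). split.
  - apply Rmult_le_pos; [auto|]. left. now apply Rinv_0_lt_compat.
  - apply Rmult_le_reg_r with (INR L); auto. unfold Rdiv. rewrite Rmult_assoc, Rinv_l by lra. lra.
Qed.

Lemma INR_sub_ratio_close L K s : (1 <= L)%nat ->
  Rabs (INR (K - s) / INR L - INR K / INR L) <= INR s * / INR L.
Proof.
  intros HL. assert (0 < / INR L) by (apply Rinv_0_lt_compat, lt_0_INR; lia).
  pose proof (INR_sub_close K s).
  replace (INR (K - s) / INR L - INR K / INR L) with (- ((INR K - INR (K - s)) * / INR L)) by (unfold Rdiv; ring).
  rewrite Rabs_Ropp, Rabs_mult, !Rabs_pos_eq; nra.
Qed.

(** The factor [(K - i)/L] is within [i/L] of [K/L]; replacing the [s] factors one at a time, all in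
    [0,1], costs at most [s^2/L]. *)
Lemma falling_ratio L K s : (1 <= L)%nat -> (K <= L)%nat ->
  0 <= falling K s * (/ INR L) ^ s <= 1 /\
  Rabs (falling K s * (/ INR L) ^ s - (INR K / INR L) ^ s) <= INR s * INR s * / INR L.
Proof.
  intros HL HK. assert (0 < / INR L) by (apply Rinv_0_lt_compat, lt_0_INR; lia).
  assert (U := INR_ratio_unit L K HL HK).
  induction s as [|s [IH1 IH2]].
  - simpl. rewrite Rmult_1_r, Rminus_diag, Rabs_R0. lra.
  - assert (V := INR_ratio_unit L (K - s) HL ltac:(lia)).
    assert (E : falling K (S s) * (/ INR L) ^ S s = falling K s * (/ INR L) ^ s * (INR (K - s) / INR L)).
    { cbn [falling pow]. unfold Rdiv. ring. }
    rewrite E. split; [nra|]. simpl pow. rewrite (Rmult_comm (INR K / INR L)).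
    eapply Rle_trans; [apply Rabs_mult_sub_le; [exact IH1|exact U]|].
    pose proof (INR_sub_ratio_close L K s HL). rewrite S_INR. pose proof (pos_INR s). nra.
Qed.

(** Separates the [s] balls that hit the first [n] bins from the [K - s] balls that each miss them
    with probability [1 - n/L], so that the two factors can be estimated apart. *)
Lemma marg_falling L n K b : (1 <= L)%nat -> (n <= L)%nat ->
  marg L n K b = / fact_prod b *
    (falling K (list_sum b) * (/ INR L) ^ list_sum b * (1 - INR n / INR L) ^ (K - list_sum b)).
Proof.
  intros HL Hn. unfold marg. set (s := list_sum b).
  assert (0 < INR L) by (apply lt_0_INR; lia). pose proof (fact_prod_ge1 b).
  destruct (Nat.leb_spec s K) as [Hs|Hs]; [|rewrite falling_gt by auto; ring].
  rewrite (falling_fact K s Hs).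
  replace ((/ INR L) ^ K) with ((/ INR L) ^ s * (/ INR L) ^ (K - s)) by (rewrite <- pow_add; f_equal; lia).
  replace (1 - INR n / INR L) with (/ INR L * INR (L - n)) by (rewrite minus_INR by auto; field; lra).
  rewrite Rpow_mult_distr. field. repeat split; try lra. apply INR_fact_neq_0.
Qed.

(** The target is a product of [n] Poisson weights. With [d = |K/L - rho|], replacing the hitting
    factor by [rho^s] costs [s^2/L + s d], and replacing the missing factor by [exp (- n rho)] costs
    [n^2/L + n (s/L + d)]. The constant is the sum of all these coefficients. *)
Lemma marg_approx L n K b rho : (1 <= L)%nat -> (n <= L)%nat -> (K <= L)%nat -> 0 <= rho <= 1 ->
  let s := list_sum b in
  Rabs (marg L n K b - exp (- (INR n * rho)) * rho ^ s / fact_prod b)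
  <= (INR s * INR s + INR n * INR n + INR n * INR s + INR s + INR n)
     * (/ INR L + Rabs (INR K / INR L - rho)).
Proof.
  intros HL Hn HK Hr s. rewrite marg_falling by auto. fold s.
  assert (Li : 0 < / INR L) by (apply Rinv_0_lt_compat, lt_0_INR; lia).
  assert (Lp : 0 < INR L) by (apply lt_0_INR; lia).
  set (u := INR K / INR L). assert (U : 0 <= u <= 1) by now apply INR_ratio_unit.
  set (v := INR n / INR L). assert (V : 0 <= v <= 1) by now apply INR_ratio_unit.
  set (d := Rabs (u - rho)). assert (Hd : 0 <= d) by apply Rabs_pos.
  destruct (falling_ratio L K s HL HK) as [F1 F2]. fold u in F2.
  set (A := falling K s * (/ INR L) ^ s) in *. set (B := (1 - v) ^ (K - s)).
  set (j := (K - s)%nat) in *. set (w := INR j / INR L).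
  assert (W : 0 <= w <= 1) by (apply INR_ratio_unit; unfold j; lia).
  assert (Wu : Rabs (w - u) <= INR s * / INR L) by (apply INR_sub_ratio_close; auto).
  pose proof (pos_INR n) as Pn. pose proof (pos_INR s) as Ps.
  (* Each of the [K - s] factors is off by at most [v^2] with [v = n/L]; as [(K - s)/L <= 1], the
     total is at most [n^2/L]. *)
  assert (EB : Rabs (B - exp (- (INR n * w))) <= INR n * INR n * / INR L).
  { replace (exp (- (INR n * w))) with (exp (- v) ^ j).
    2:{ rewrite pow_exp. f_equal. unfold w, v. field. lra. }
    assert (E01 : 0 <= exp (- v) <= 1).
    { split; [left; apply exp_pos|].       pose proof (exp_ineq1_le v). pose proof (exp_pos (- v)).
      assert (exp (- v) * exp v = 1) by (rewrite <- exp_plus, Rplus_opp_l; apply exp_0). nra. }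
    eapply Rle_trans; [apply pow_lipschitz; lra|].
    apply Rle_trans with (INR j * v ^ 2).
    { apply Rmult_le_compat_l; [apply pos_INR|]. apply exp_opp_quadratic; lra. }
    replace (INR j * v ^ 2) with (w * (INR n * INR n * / INR L)) by (unfold w, v; field; lra).
    assert (0 <= INR n * INR n * / INR L) by (apply Rmult_le_pos; nra). nra. }
  assert (EB2 : Rabs (exp (- (INR n * w)) - exp (- (INR n * rho))) <= INR n * (INR s * / INR L + d)).
  { eapply Rle_trans; [apply exp_opp_lipschitz; nra|].
    rewrite <- Rmult_minus_distr_l, Rabs_mult, (Rabs_pos_eq (INR n)) by auto.
    apply Rmult_le_compat_l; [auto|]. replace (w - rho) with ((w - u) + (u - rho)) by ring.
    eapply Rle_trans; [apply Rabs_triang|]. fold d. lra. }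
  assert (EA : Rabs (A - rho ^ s) <= INR s * INR s * / INR L + INR s * d).
  { replace (A - rho ^ s) with ((A - u ^ s) + (u ^ s - rho ^ s)) by ring.
    eapply Rle_trans; [apply Rabs_triang|]. pose proof (pow_lipschitz u rho s U Hr). fold d in H. lra. }
  assert (EB3 : Rabs (B - exp (- (INR n * rho))) <= INR n * INR n * / INR L + INR n * (INR s * / INR L + d)).
  { replace (B - exp (- (INR n * rho))) with ((B - exp (- (INR n * w))) + (exp (- (INR n * w)) - exp (- (INR n * rho)))) by ring.
    eapply Rle_trans; [apply Rabs_triang|]. lra. }
  assert (E01 : 0 <= exp (- (INR n * rho)) <= 1).
  { split; [left; apply exp_pos|]. set (r := INR n * rho). assert (0 <= r) by (unfold r; nra).
    pose proof (exp_ineq1_le r). pose proof (exp_pos (- r)).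
    assert (exp (- r) * exp r = 1) by (rewrite <- exp_plus, Rplus_opp_l; apply exp_0). nra. }
  pose proof (fact_prod_ge1 b) as Fb.
  replace (/ fact_prod b * (A * B) - exp (- (INR n * rho)) * rho ^ s / fact_prod b)
    with (/ fact_prod b * (A * B - rho ^ s * exp (- (INR n * rho)))) by (field; lra).
  assert (Fi : 0 < / fact_prod b <= 1).
  { split; [apply Rinv_0_lt_compat; lra|]. rewrite <- Rinv_1. apply Rinv_le_contravar; lra. }
  rewrite Rabs_mult, (Rabs_pos_eq (/ fact_prod b)) by lra.
  assert (AB := Rabs_mult_sub_le A B (rho ^ s) (exp (- (INR n * rho))) F1 E01).
  pose proof (Rabs_pos (A * B - rho ^ s * exp (- (INR n * rho)))).
  apply Rle_trans with (Rabs (A * B - rho ^ s * exp (- (INR n * rho)))); [nra|].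
  eapply Rle_trans; [exact AB|].
  assert (0 <= INR s * INR s * d) by (repeat apply Rmult_le_pos; auto).
  assert (0 <= INR n * INR n * d) by (repeat apply Rmult_le_pos; auto).
  assert (0 <= INR n * INR s * d) by (repeat apply Rmult_le_pos; auto).
  assert (0 <= INR s * / INR L) by (apply Rmult_le_pos; lra).
  assert (0 <= INR n * / INR L) by (apply Rmult_le_pos; lra).
  lra.
Qed.

(** One formula for empty and nonempty bins, in the shape of [feasible] and [bvec], to match the
    finite system. *)
Lemma nl_step_wbit rho x y :
  nl_step rho x y = if (x <=? y + wbit x)%nat then poisson rho (y + wbit x - x) else 0.
Proof.
  unfold nl_step, wbit. destruct (Nat.eqb_spec x 0) as [->|Hx].
  - rewrite Nat.add_0_r, Nat.sub_0_r. reflexivity.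
  - destruct (Nat.ltb_spec (y + 1) x), (Nat.leb_spec x (y + 1)); auto; lia.
Qed.

(** Independent Poisson weights with a common mean multiply to the target of [marg_approx]. *)
Lemma nl_step_prod rho z z' : length z = length z' ->
  Rprod (map (fun p => nl_step rho (fst p) (snd p)) (combine z z')) =
  if feasible z z'
  then exp (- (INR (length z) * rho)) * rho ^ list_sum (bvec z z') / fact_prod (bvec z z') else 0.
Proof.
  revert z'. induction z as [|a z IH]; intros [|b z'] H; try discriminate.
  - unfold fact_prod. simpl. rewrite Rmult_0_l, Ropp_0, exp_0. field.
  - injection H as H. specialize (IH z' H). cbn [combine map Rprod fold_right fst snd].
    unfold Rprod in IH. rewrite IH, nl_step_wbit.
    unfold feasible, bvec, fact_prod. cbn [combine map forallb fst snd list_sum fold_right Rprod length].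
    destruct Nat.leb; [|simpl; ring]. simpl andb. destruct forallb; [|ring].
    unfold poisson. rewrite S_INR.
    replace (- ((INR (length z) + 1) * rho)) with (- rho + - (INR (length z) * rho)) by ring.
    rewrite exp_plus, pow_add. fold (list_sum (map (fun p : nat * nat => (snd p + wbit (fst p) - fst p)%nat) (combine z z'))).
    pose proof (fact_prod_ge1 (bvec z z')) as Q. unfold fact_prod, Rprod, bvec in Q.
    unfold Rprod. field. split; [lra|apply INR_fact_neq_0].
Qed.

Lemma occ_le x : (occ x <= length x)%nat.
Proof. unfold occ, list_sum. induction x as [|a x IH]; simpl; [lia|]. unfold wbit at 1. destruct Nat.eqb; lia. Qed.

(** [C] depends on [z] and [z'] alone, and this uniformity in [x] is what allows the error to be
    averaged over the state. For an infeasible move both terms are 0. *)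
Lemma prefix_kernel_approx rho z z' : 0 <= rho <= 1 -> length z = length z' ->
  exists C, 0 <= C /\ forall L x, (1 <= L)%nat -> (length z <= L)%nat -> length x = L -> firstn (length z) x = z ->
    Rabs (prefix_kernel L (length z) z' x - Rprod (map (fun p => nl_step rho (fst p) (snd p)) (combine z z')))
    <= C * (/ INR L + Rabs (INR (occ x) / INR L - rho)).
Proof.
  intros Hr Hz. rewrite nl_step_prod by auto.
  set (s := list_sum (bvec z z')). set (n := length z).
  exists (INR s * INR s + INR n * INR n + INR n * INR s + INR s + INR n).
  pose proof (pos_INR n) as Pn. pose proof (pos_INR s) as Ps.
  assert (C0 : 0 <= INR s * INR s + INR n * INR n + INR n * INR s + INR s + INR n) by nra.
  split; [exact C0|]. intros L x HL Hn Hx Hp. unfold prefix_kernel. fold n in Hp. rewrite Hp.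
  destruct feasible.
  - apply marg_approx; auto. rewrite <- Hx. apply occ_le.
  - rewrite Rminus_diag, Rabs_R0. apply Rmult_le_pos; [exact C0|].
    assert (0 < / INR L) by (apply Rinv_0_lt_compat, lt_0_INR; lia).
    pose proof (Rabs_pos (INR (occ x) / INR L - rho)). lra.
Qed.

(** * The nonlinear process *)

Lemma poisson_nonneg m k : 0 <= m -> 0 <= poisson m k.
Proof.
  intros Hm. unfold poisson. repeat apply Rmult_le_pos.
  - left. apply exp_pos.
  - now apply pow_le.
  - left. apply Rinv_0_lt_compat, INR_fact_lt_0.
Qed.

Lemma poisson_sum m : 0 <= m -> has_sum (poisson m) 1.
Proof.
  intros Hm. replace 1 with (exp (- m) * exp m) by (rewrite <- exp_plus, Rplus_opp_l; apply exp_0).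
  apply has_sum_ext with (fun k => exp (- m) * (/ INR (fact k) * m ^ k)).
  - intros k. unfold poisson, Rdiv. ring.
  - apply has_sum_scal, has_sum_infinite_sum.
    + intros k. apply Rmult_le_pos; [left; apply Rinv_0_lt_compat, INR_fact_lt_0|now apply pow_le].
    + unfold exp. destruct (exist_exp m) as [l Hl]. exact Hl.
Qed.

Lemma nl_step_nonneg rho x y : 0 <= rho -> 0 <= nl_step rho x y.
Proof. intros H. rewrite nl_step_wbit. destruct Nat.leb; [now apply poisson_nonneg|lra]. Qed.

Lemma nl_step_sum rho x : 0 <= rho -> has_sum (nl_step rho x) 1.
Proof.
  intros H. apply has_sum_reindex with (i := fun k => (k + (x - wbit x))%nat) (f := poisson rho).
  - intros k. now apply poisson_nonneg.
  - intros k _. rewrite nl_step_wbit. pose proof (wbit_le x).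
    destruct (Nat.leb_spec x (k + (x - wbit x) + wbit x)); [|lia]. f_equal. lia.
  - intros k k' _ _ E. lia.
  - intros y. rewrite nl_step_wbit. pose proof (wbit_le x). destruct (Nat.leb_spec x (y + wbit x)); [|tauto].
    intros E. exists (y + wbit x - x)%nat. split; [exact E|lia].
  - now apply poisson_sum.
Qed.

(** The facts are proved together: the next step is a Poisson kernel only if [rho] is nonnegative,
    and that comes from the current law having mass 1. *)
Lemma nl_law_prob mu t : (forall k, 0 <= mu k) -> infinite_sum mu 1 ->
  (forall k, 0 <= nl_law mu t k) /\ has_sum (nl_law mu t) 1 /\ 0 <= nl_rho mu t <= 1.
Proof.
  intros Hmu H1.
  assert (K : forall q, (forall k, 0 <= q k) -> has_sum q 1 -> 0 <= 1 - q 0%nat <= 1).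
  { intros q Hq Hs. assert (A := has_sum_partial_le q 1 [0%nat] Hq Hs ltac:(repeat constructor; auto)).
    simpl in A. specialize (Hq 0%nat). lra. }
  unfold nl_rho. induction t as [|t (I1 & I2 & I3)].
  - simpl. assert (has_sum mu 1) by now apply has_sum_infinite_sum. auto.
  - assert (N : forall k, 0 <= nl_law mu (S t) k).
    { intros k. cbn [nl_law]. apply Rsum_map_nonneg. intros x _. apply Rmult_le_pos; [auto|].
      apply nl_step_nonneg. lra. }
    assert (M : has_sum (nl_law mu (S t)) 1).
    { apply has_sum_tonelli with (f := fun x y => nl_law mu t x * nl_step (1 - nl_law mu t 0) x y)
        (F := nl_law mu t); auto.
      - intros x y. apply Rmult_le_pos; [auto|]. apply nl_step_nonneg. lra.
      - intros x. apply has_sum_scal1, nl_step_sum. lra.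
      - intros y. cbn [nl_law]. apply has_sum_finite; [apply seq_NoDup|].
        intros x Hx. rewrite nl_step_wbit.
        destruct (Nat.leb_spec x (y + wbit x)); [|ring]. exfalso. apply Hx, in_seq.
        unfold wbit in *. destruct Nat.eqb; lia. }
    auto.
Qed.

Lemma nl_chain_nonneg mu t x r : (forall k, 0 <= mu k) -> infinite_sum mu 1 -> 0 <= nl_chain mu t x r.
Proof.
  intros Hmu H1. revert t x. induction r as [|y r IH]; intros t x; simpl; [lra|].
  apply Rmult_le_pos; [|auto]. apply nl_step_nonneg. now apply nl_law_prob.
Qed.

Lemma nl_chain_sum mu T : (forall k, 0 <= mu k) -> infinite_sum mu 1 -> forall t x,
  has_sum (fun r => if Nat.eqb (length r) T then nl_chain mu t x r else 0) 1.
Proof.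
  intros Hmu H1. induction T as [|T IH]; intros t x.
  - apply (has_sum_single (fun r => if Nat.eqb (length r) 0 then nl_chain mu t x r else 0) []).
    intros [|y r] H; [congruence|reflexivity].
  - apply has_sum_cons with (F := nl_step (nl_rho mu t) x).
    + intros r. destruct Nat.eqb; [now apply nl_chain_nonneg|lra].
    + reflexivity.
    + intros y. eapply has_sum_ext; [|apply has_sum_scal1, (IH (S t) y)].
      intros r. simpl. destruct Nat.eqb; ring.
    + apply nl_step_sum. now apply nl_law_prob.
Qed.

Lemma nl_path_nonneg mu w : (forall k, 0 <= mu k) -> infinite_sum mu 1 -> 0 <= nl_path mu w.
Proof.
  intros Hmu H1. destruct w; simpl; [lra|]. apply Rmult_le_pos; [auto|now apply nl_chain_nonneg].
Qed.

Lemma nl_path_sum mu T : (forall k, 0 <= mu k) -> infinite_sum mu 1 ->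
  has_sum (fun w => if Nat.eqb (length w) (T + 1) then nl_path mu w else 0) 1.
Proof.
  intros Hmu H1. rewrite Nat.add_1_r. apply has_sum_cons with (F := mu).
  - intros w. destruct Nat.eqb; [now apply nl_path_nonneg|lra].
  - reflexivity.
  - intros x. eapply has_sum_ext; [|apply has_sum_scal1, (nl_chain_sum mu T Hmu H1 0 x)].
    intros r. simpl. destruct Nat.eqb; ring.
  - now apply has_sum_infinite_sum.
Qed.

(** * Propagation of chaos *)

(* Any value when [f] is not summable. *)
Definition total {X : Type} (f : X -> R) : R := epsilon (inhabits 0) (has_sum f).

Lemma total_spec {X : Type} (f : X -> R) : (exists s, has_sum f s) -> has_sum f (total f).
Proof. apply epsilon_spec. Qed.

(** For fixed [d] the bound tends to [C d], and [d] is arbitrary. *)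
Lemma squeeze_small e h D C :
  0 <= C -> Un_cv D 0 -> Un_cv h 0 ->
  (exists N, forall d L, 0 < d -> (N <= L)%nat -> Rabs (e L) <= C * (h L + d + D L / d)) ->
  Un_cv e 0.
Proof.
  (* [C + 1] keeps the denominator positive and gives [C d <= eps / 2]. *)
  intros HC HD Hh [N He] eps Heps. set (d := eps / (2 * (C + 1))).
  assert (Hd : 0 < d) by (unfold d; apply Rdiv_lt_0_compat; lra).
  assert (U : Un_cv (fun L => C * (h L + d + D L * / d)) (C * (0 + d + 0 * / d))).
  { apply CV_mult; [apply Un_cv_const|]. apply (CV_plus (fun L => h L + d)).
    - apply CV_plus; [exact Hh|apply Un_cv_const].
    - apply CV_mult; [exact HD|apply Un_cv_const]. }
  destruct (U (eps / 2)) as [N' HN']; [lra|]. exists (N + N')%nat. intros L HL.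
  specialize (HN' L ltac:(lia)). specialize (He d L Hd ltac:(lia)).
  unfold Rdist in *. rewrite Rminus_0_r.
  assert (E : C * (0 + d + 0 * / d) <= eps / 2).
  { replace (C * (0 + d + 0 * / d)) with (C / (C + 1) * (eps / 2)) by (unfold d; field; split; lra).
    assert (C / (C + 1) <= 1); [|nra]. apply Rmult_le_reg_r with (C + 1); [lra|].
    unfold Rdiv. rewrite Rmult_assoc, Rinv_l; lra. }
  apply Rabs_def2 in HN'. unfold Rdiv in He. lra.
Qed.

(** Passes from second to first moments without Cauchy-Schwarz: beyond [d], [|t|] is at most
    [t^2 / d]. *)
Lemma Rabs_le_sq t d : 0 < d -> Rabs t <= d + t ^ 2 / d.
Proof.
  intros Hd. apply Rmult_le_reg_r with d; [exact Hd|].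
  replace ((d + t ^ 2 / d) * d) with (d * d + t ^ 2) by (field; lra).
  rewrite <- (pow2_abs t). pose proof (Rabs_pos t). nra.
Qed.

(** Here [f] is the mass of a past event on which the present prefix is [z]. On its support the
    chance of moving to prefix [z'] is the constant [g] up to [C (1/L + |K/L - rho|)], and [f <= q]
    lets this error be averaged under [q], where the second moment [D] tends to 0. *)
Lemma step_mass_limit (q f : nat -> list nat -> R) rho z z' c D :
  0 <= rho <= 1 -> length z = length z' ->
  (forall L, (1 <= L)%nat -> (forall x, 0 <= q L x) /\ (forall x, q L x <> 0 -> length x = L) /\ has_sum (q L) 1) ->
  (forall L x, (1 <= L)%nat -> 0 <= f L x <= q L x) ->
  (forall L x, (1 <= L)%nat -> f L x <> 0 -> firstn (length z) x = z) ->
  (forall L, (2 <= L)%nat -> has_sum (fun x => q L x * (INR (occ x) / INR L - rho) ^ 2) (D L)) ->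
  Un_cv D 0 ->
  mass_limit (length z) f c ->
  mass_limit (length z) (fun L => step L (length z) z' (f L))
    (c * Rprod (map (fun p => nl_step rho (fst p) (snd p)) (combine z z'))).
Proof.
  intros Hr Hz Hq Hf Hp HD LD (m & Hm & Lm).
  set (g := Rprod _). set (n := length z) in *.
  assert (Fs : forall L x, (1 <= L)%nat -> f L x <> 0 -> length x = L).
  { intros L x HL Hx. destruct (Hq L HL) as (_ & Q2 & _). apply Q2. intros E.
    specialize (Hf L x HL). rewrite E in Hf. apply Hx. lra. }
  set (m' := fun L => total (fun x => f L x * prefix_kernel L n z' x)).
  assert (Hm' : forall L, (1 <= L)%nat -> (n <= L)%nat -> has_sum (fun x => f L x * prefix_kernel L n z' x) (m' L)).
  { intros L HL Hn. apply total_spec.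
    destruct (has_sum_dominated_nonneg (fun x => f L x * prefix_kernel L n z' x) (f L) (m L)) as (s & Hs & _); eauto.
    intros x. specialize (Hf L x HL). destruct (Req_dec (f L x) 0) as [->|E]; [lra|].
    pose proof (prefix_kernel_bounds L n z' x HL Hn (Fs L x HL E) (eq_sym Hz)). nra. }
  exists m'. split.
  { intros L HL Hn. apply step_sum; auto; intros; now apply Hf. }
  destruct (prefix_kernel_approx rho z z' Hr Hz) as (C & HC & HA). fold n g in HA.
  assert (U : Un_cv (fun L => m' L - m L * g) 0).
  { apply squeeze_small with (h := fun L => / INR L) (D := D) (C := C); auto; [apply Un_cv_inv_INR|].
    exists (2 + n)%nat. intros d L Hd HL. destruct (Hq L) as (Q1 & Q2 & Q3); [lia|].
    assert (S1 : has_sum (fun x => f L x * prefix_kernel L n z' x - g * f L x) (m' L - m L * g)).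
    { rewrite (Rmult_comm (m L)). apply has_sum_minus; [apply Hm'; lia|].
      apply has_sum_scal, Hm; lia. }
    assert (S2 : has_sum (fun x => C * ((/ INR L + d) * q L x + / d * (q L x * (INR (occ x) / INR L - rho) ^ 2)))
                   (C * (/ INR L + d + D L / d))).
    { apply has_sum_scal. replace (/ INR L + d + D L / d) with ((/ INR L + d) * 1 + / d * D L) by (unfold Rdiv; ring).
      apply has_sum_plus; apply has_sum_scal; [exact Q3|apply HD; lia]. }
    refine (let '(ex_intro _ s (conj Hs Hle)) := has_sum_dominated _ _ _ _ S2 in _).
    - intros x. simpl. specialize (Hf L x ltac:(lia)).
      assert (Lp : 0 < / INR L) by (apply Rinv_0_lt_compat, lt_0_INR; lia).
      set (u := INR (occ x) / INR L - rho).
      assert (B : Rabs (f L x * prefix_kernel L n z' x - g * f L x) <= q L x * (C * (/ INR L + (d + u ^ 2 / d)))).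
      { assert (P : 0 <= C * (/ INR L + (d + u ^ 2 / d))).
        { pose proof (Rabs_le_sq u d Hd). pose proof (Rabs_pos u). apply Rmult_le_pos; lra. }
        destruct (Req_dec (f L x) 0) as [E|E].
        { rewrite E, Rmult_0_l, Rmult_0_r, Rminus_0_r, Rabs_R0. now apply Rmult_le_pos. }
        replace (f L x * prefix_kernel L n z' x - g * f L x) with (f L x * (prefix_kernel L n z' x - g)) by ring.
        rewrite Rabs_mult, (Rabs_pos_eq (f L x)) by lra.
        apply Rmult_le_compat; [lra|apply Rabs_pos|lra|].
        eapply Rle_trans; [apply HA; auto; try lia|].
        - apply Fs; auto; lia.
        - apply Hp with L; auto; lia.
        - apply Rmult_le_compat_l; [exact HC|]. fold u. pose proof (Rabs_le_sq u d Hd). lra. }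
      eapply Rle_trans; [exact B|]. right. unfold Rdiv. ring.
    - now rewrite (has_sum_unique _ _ _ S1 Hs). }
  apply Un_cv_limit_eq with (0 + c * g); [ring|].
  apply (Un_cv_eventually (fun L => (m' L - m L * g) + m L * g) _ _ 0%nat); [intros; ring|].
  apply CV_plus; [exact U|]. apply CV_mult; [exact Lm|apply Un_cv_const].
Qed.

Lemma mass_limit_Rsum {I : Type} n (F : I -> nat -> list nat -> R) (c : I -> R) (l : list I) :
  (forall i, In i l -> mass_limit n (F i) (c i)) ->
  mass_limit n (fun L x => Rsum (map (fun i => F i L x) l)) (Rsum (map c l)).
Proof.
  induction l as [|i l IH]; intros H.
  - exists (fun _ => 0). split; [|apply Un_cv_const]. intros. apply has_sum_zero.
  - destruct IH as (m & Hm & Lm); [intros; apply H; now right|].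
    destruct (H i (or_introl eq_refl)) as (m' & Hm' & Lm').
    exists (fun L => m' L + m L). split; [|now apply CV_plus].
    intros L HL Hn. simpl. apply has_sum_plus; [now apply Hm'|now apply Hm].
Qed.

Lemma mass_limit_ext n f g c :
  (forall L x, (1 <= L)%nat -> (n <= L)%nat -> f L x = g L x) -> mass_limit n f c -> mass_limit n g c.
Proof.
  intros H (m & Hm & Lm). exists m. split; [|exact Lm].
  intros L HL Hn. eapply has_sum_ext; [|now apply Hm]. intros x. now apply H.
Qed.

(** Predecessors of a state with prefix [z'] have their own prefix in the finite [box z']. Splitting
    by that prefix gives finitely many pieces, each with the fixed starting prefix that
    [step_mass_limit] asks for. *)
Lemma restrict_step L n z' f y : length z' = n -> (n <= L)%nat ->
  restrict n z' (step L 0 [] f) y = Rsum (map (fun z => step L n z' (restrict n z f) y) (box z')).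
Proof.
  intros Hz Hn. unfold restrict at 1. unfold step at 2. destruct (list_eq_dec Nat.eq_dec (firstn n y) z') as [E|E].
  2:{ symmetry. now apply Rsum_map_zero. }
  rewrite Rsum_swap. unfold step. simpl. apply Rsum_map_ext. intros x Hx.
  rewrite (Rsum_map_ext _ (fun z => (if list_eq_dec Nat.eq_dec (firstn n x) z then f x else 0) * rbb_kernel L x y)) by reflexivity.
  (* Each [x] is counted for exactly one prefix of the box, its own. *)
  rewrite (Rsum_incl_zero _ [firstn n x]).
  - simpl. destruct list_eq_dec; [ring|congruence].
  - repeat constructor; auto.
  - apply NoDup_box.
  - intros w [<-|[]]. rewrite <- E. apply in_box. apply in_box in Hx. clear - Hx. revert n. induction Hx; intros [|n]; simpl; constructor; auto.
  - intros w _ Hw. destruct list_eq_dec as [e|]; [|ring]. exfalso. apply Hw. now left.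
Qed.

(** Distributivity over a Cartesian product. It makes the limit weights, summed over predecessor
    prefixes, factor over bins again. *)
Lemma box_prod (a : nat -> R) (b : nat -> nat -> R) z' :
  Rsum (map (fun z => Rprod (map a z) * Rprod (map (fun p => b (fst p) (snd p)) (combine z z'))) (box z'))
  = Rprod (map (fun y => Rsum (map (fun x => a x * b x y) (seq 0 (y + 2)))) z').
Proof.
  induction z' as [|y z' IH]; [simpl; ring|]. rewrite box_sum_cons.
  cbn [map Rprod fold_right]. unfold Rprod in *. rewrite <- IH, Rmult_comm, <- Rsum_map_scal.
  apply Rsum_map_ext. intros i _. rewrite Rmult_comm, <- Rsum_map_scal.
  apply Rsum_map_ext. intros z _. simpl. ring.
Qed.

Lemma restrict_le n z f x : 0 <= f x -> 0 <= restrict n z f x <= f x.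
Proof. unfold restrict. destruct list_eq_dec; lra. Qed.

Lemma restrict_support n z f x : restrict n z f x <> 0 -> firstn n x = z.
Proof. unfold restrict. destruct list_eq_dec; tauto. Qed.

(** Mass of the current state on the event that the successive prefixes were [zs], started from the
    mass [f]. *)
Fixpoint steps (L n : nat) (f : list nat -> R) (zs : list (list nat)) : list nat -> R :=
  match zs with [] => f | z :: zs' => steps L n (step L n z f) zs' end.

(** Probability that independent nonlinear copies, in states [z] at time [t], go through the
    successive joint states [zs]. *)
Fixpoint nl_weight (mu : nat -> R) (t : nat) (z : list nat) (zs : list (list nat)) : R :=
  match zs with
  | [] => 1
  | z' :: zs' => Rprod (map (fun p => nl_step (nl_rho mu t) (fst p) (snd p)) (combine z z')) * nl_weight mu (S t) z' zs'
  end.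

Section Chaos.
Variables (p0 : nat -> list nat -> R) (mu : nat -> R).
Hypothesis Hp0_nonneg : forall L x, (1 <= L)%nat -> 0 <= p0 L x.
Hypothesis Hp0_supp : forall L x, (1 <= L)%nat -> length x <> L -> p0 L x = 0.
Hypothesis Hp0_prob : forall L, (1 <= L)%nat -> has_sum (p0 L) 1.
Hypothesis Hp0_exch : forall L x y, (1 <= L)%nat -> Permutation x y -> p0 L x = p0 L y.
Hypothesis Hmu_nonneg : forall k, 0 <= mu k.
Hypothesis Hmu_prob : infinite_sum mu 1.
Hypothesis Hchaos : forall xi, (1 <= length xi)%nat ->
  mass_limit (length xi) (fun L => restrict (length xi) xi (p0 L)) (Rprod (map mu xi)).

Let law L t := rbb_law L (p0 L) t.

Lemma law_prob t L : (1 <= L)%nat ->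
  (forall x, 0 <= law L t x) /\ (forall x, law L t x <> 0 -> length x = L) /\ has_sum (law L t) 1.
Proof. intros HL. apply rbb_law_prob; auto. Qed.

Definition chaotic t := forall z, (1 <= length z)%nat ->
  mass_limit (length z) (fun L => restrict (length z) z (law L t)) (Rprod (map (nl_law mu t) z)).

Lemma chaotic_occ t : chaotic t -> exists D,
  (forall L, (2 <= L)%nat -> has_sum (fun x => law L t x * (INR (occ x) / INR L - nl_rho mu t) ^ 2) (D L)) /\
  Un_cv D 0.
Proof.
  intros H. apply occ_lln.
  - apply law_prob.
  - intros L x y HL. apply rbb_law_perm. intros; now apply Hp0_exch.
  - replace (nl_law mu t 0) with (Rprod (map (nl_law mu t) [0%nat])) by (simpl; ring).
    apply (H [0%nat]). simpl; lia.
  - replace (nl_law mu t 0 * nl_law mu t 0) with (Rprod (map (nl_law mu t) [0%nat; 0%nat])) by (simpl; ring).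
    apply (H [0%nat; 0%nat]). simpl; lia.
Qed.

Lemma law_chaotic t : chaotic t.
Proof.
  induction t as [|t IH]; [exact Hchaos|]. intros z' Hz'. set (n := length z').
  destruct (chaotic_occ t IH) as (D & HD & LD).
  apply mass_limit_ext with
    (f := fun L y => Rsum (map (fun z => step L n z' (restrict n z (law L t)) y) (box z'))).
  { intros L y HL Hn. unfold law. rewrite rbb_law_step. symmetry. now apply restrict_step. }
  cbn [nl_law]. rewrite <- (box_prod (nl_law mu t) (nl_step (1 - nl_law mu t 0))).
  apply (mass_limit_Rsum n (fun z L => step L n z' (restrict n z (law L t)))).
  intros z Hz. apply in_box_length in Hz. unfold n. rewrite <- Hz.
  apply step_mass_limit with (q := fun L => law L t) (D := D); auto.
  - now apply nl_law_prob.
  - apply law_prob.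
  - intros L x HL. apply restrict_le. now apply law_prob.
  - intros L x HL. apply restrict_support.
  - apply IH. lia.
Qed.

(** The conditions on [f] reproduce themselves: [step] is monotone, so its result stays below the
    law at time [t + 1], and it lives on the new prefix. *)
Lemma steps_mass_limit n zs : Forall (fun z => length z = n) zs -> forall t z f c, length z = n ->
  (forall L x, (1 <= L)%nat -> 0 <= f L x <= law L t x) ->
  (forall L x, (1 <= L)%nat -> f L x <> 0 -> firstn n x = z) ->
  mass_limit n f c ->
  mass_limit n (fun L => steps L n (f L) zs) (c * nl_weight mu t z zs).
Proof.
  induction 1 as [|z' zs Hz' Hzs IH]; intros t z f c Hz Hf Hs Hm.
  - simpl. now rewrite Rmult_1_r.
  - cbn [steps nl_weight]. rewrite <- Rmult_assoc.
    apply (IH (S t) z' (fun L => step L n z' (f L))); [exact Hz'| | |].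
    + intros L x HL. split; [apply step_nonneg; [auto|]; intros; now apply Hf|].
      unfold law. rewrite rbb_law_step. unfold step. simpl.
      assert (0 <= Rsum (map (fun w => rbb_law L (p0 L) t w * rbb_kernel L w x) (box x))).
      { apply Rsum_map_nonneg. intros w _. apply Rmult_le_pos; [now apply law_prob|now apply rbb_kernel_nonneg]. }
      destruct list_eq_dec; [|auto]. apply Rsum_map_le. intros w _.
      apply Rmult_le_compat_r; [now apply rbb_kernel_nonneg|]. now apply Hf.
    + intros L x HL Hx. now apply step_support in Hx.
    + destruct (chaotic_occ t (law_chaotic t)) as (D & HD & LD). rewrite <- Hz.
      apply step_mass_limit with (q := fun L => law L t) (D := D); auto; rewrite ?Hz; auto.
      * now apply nl_law_prob.
      * apply law_prob.
Qed.
End Chaos.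

(** * Sums over paths *)

(** Only the states after the first are tested; a constraint on the initial prefix is imposed
    through [f]. *)
Definition prefix_path (L n : nat) (f : list nat -> R) (zs path : list (list nat)) : R :=
  match path with
  | [] => 0
  | x :: r => if ceq (map (firstn n) r) zs then f x * rbb_chain L x r else 0
  end.

Lemma rbb_chain_nonneg L x r : (1 <= L)%nat -> 0 <= rbb_chain L x r.
Proof.
  intros HL. revert x. induction r as [|y r IH]; intros x; simpl; [lra|].
  apply Rmult_le_pos; [now apply rbb_kernel_nonneg|auto].
Qed.

Lemma prefix_path_nonneg L n f zs path : (1 <= L)%nat -> (forall x, 0 <= f x) -> 0 <= prefix_path L n f zs path.
Proof.
  intros HL Hf. destruct path as [|x r]; simpl; [lra|]. destruct ceq; [|lra].
  apply Rmult_le_pos; [auto|now apply rbb_chain_nonneg].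
Qed.

(** [steps] sums out the past as time advances, while a path keeps all its states. Grouping paths by
    their tail reconciles them: summing the first state over a fibre produces one [step]. *)
Lemma prefix_path_sum L n zs : (1 <= L)%nat -> forall f s, (forall x, 0 <= f x) ->
  has_sum (steps L n f zs) s -> has_sum (prefix_path L n f zs) s.
Proof.
  intros HL. induction zs as [|z zs IH]; intros f s Hf Hs.
  - apply has_sum_reindex with (i := fun x => [x]) (f := f); auto.
    + intros x _. simpl. destruct ceq; [ring|tauto].
    + intros x x' _ _ [= E]. exact E.
    + intros [|x r]; simpl; [tauto|]. destruct ceq as [e|]; [|tauto].
      apply map_eq_nil in e. subst r. simpl. rewrite Rmult_1_r. eauto.
  - simpl in Hs. apply IH in Hs; [|intros; now apply step_nonneg].
    refine (proj2 (has_sum_fibres (@tl (list nat)) _ _ s _ _) Hs).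
    + intros path. now apply prefix_path_nonneg.
    + intros [|y r].
      (* A path with fewer than two states has an empty tail and cannot follow the nonempty
         [z :: zs]. *)
      { eapply has_sum_ext; [|apply has_sum_zero]. intros [|x [|y r]]; simpl; destruct ceq; auto.
        - destruct ceq; [discriminate|reflexivity].
        - discriminate. }
      simpl. unfold step. destruct (list_eq_dec Nat.eq_dec (firstn n y) z) as [Ez|Ez].
      2:{ assert ((if ceq (map (firstn n) r) zs then 0 * rbb_chain L y r else 0) = 0) as ->
            by (destruct ceq; ring).
          eapply has_sum_ext; [|apply has_sum_zero]. intros path; simpl. destruct ceq as [e|]; auto.
          destruct path as [|x r']; [discriminate|]. simpl in e. subst r'. simpl. destruct ceq; congruence. }
      destruct (ceq (map (firstn n) r) zs) as [Er|Er].
      2:{ eapply has_sum_ext; [|apply has_sum_zero]. intros path; simpl. destruct ceq as [e|]; auto.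
          destruct path as [|x r']; [discriminate|]. simpl in e. subst r'. simpl. destruct ceq; [congruence|reflexivity]. }
      rewrite Rmult_comm.
      apply has_sum_reindex with (i := fun x => x :: y :: r)
        (f := fun x => rbb_chain L y r * (f x * rbb_kernel L x y)).
      * intros x. apply Rmult_le_pos; [now apply rbb_chain_nonneg|].
        apply Rmult_le_pos; [auto|now apply rbb_kernel_nonneg].
      * intros x _. simpl. destruct ceq; [|congruence]. destruct ceq; [ring|congruence].
      * intros x x' _ _ [= E]. exact E.
      * intros path Hp. destruct ceq as [e|]; [|tauto]. destruct path as [|x r']; [discriminate|].
        simpl in e. subst r'. exists x. split; [|reflexivity]. simpl in Hp. destruct ceq; [|tauto]. lra.
      * apply has_sum_scal, column_sum.
Qed.

Lemma steps_total L T : (1 <= L)%nat -> forall f s,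
  (forall x, 0 <= f x) -> (forall x, f x <> 0 -> length x = L) ->
  has_sum f s -> has_sum (steps L 0 f (repeat [] T)) s.
Proof.
  intros HL. induction T as [|T IH]; intros f s Hf Hs H; [exact H|].
  simpl. apply IH.
  - intros x. now apply step_nonneg.
  - intros x Hx. now apply step_support in Hx.
  - now apply step_total.
Qed.

Lemma map_const_repeat {X Y : Type} (c : Y) (l : list X) : map (fun _ => c) l = repeat c (length l).
Proof. induction l; simpl; congruence. Qed.

(** For prefixes of length 0 the constraint on a path is only its length. *)
Lemma rbb_path_sum L p T : (1 <= L)%nat -> (forall x, 0 <= p x) ->
  (forall x, length x <> L -> p x = 0) -> has_sum p 1 ->
  has_sum (fun path => if Nat.eqb (length path) (T + 1) then rbb_path L p path else 0) 1.
Proof.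
  intros HL Hp Hs H. rewrite Nat.add_1_r.
  apply has_sum_ext with (prefix_path L 0 p (repeat [] T)).
  - intros [|x r]; [reflexivity|]. simpl.
    change (map (fun _ : list nat => []) r) with (map (firstn 0) r).
    replace (map (firstn 0) r) with (repeat (@nil nat) (length r)).
    2:{ symmetry. exact (map_const_repeat [] r). }
    destruct ceq as [e|e], (Nat.eqb_spec (length r) T) as [E|E]; auto.
    + exfalso. apply E. apply (f_equal (@length (list nat))) in e. now rewrite !repeat_length in e.
    + congruence.
  - apply prefix_path_sum; auto. apply steps_total; auto.
    intros x Hx. apply NNPP. intros E. now apply Hx, Hs.
Qed.

(** * States indexed by time versus trajectories indexed by bin *)

Lemma map_nth_seq {X : Type} (d : X) l : map (fun i => nth i l d) (seq 0 (length l)) = l.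
Proof.
  induction l as [|a l IH]; [reflexivity|]. cbn [length seq map nth]. f_equal.
  rewrite <- seq_shift, map_map. exact IH.
Qed.

(** The width [m] is explicit so that it survives an empty [A], and so that [m = n] keeps just the
    first [n] bins. *)
Definition transpose (m : nat) (A : list (list nat)) : list (list nat) :=
  map (fun k => map (fun row => nth k row 0%nat) A) (seq 0 m).

Lemma transpose_length m A : length (transpose m A) = m.
Proof. unfold transpose. now rewrite length_map, length_seq. Qed.

Lemma transpose_rows m A w : In w (transpose m A) -> length w = length A.
Proof. intros H. apply in_map_iff in H. destruct H as (k & <- & _). apply length_map. Qed.

Lemma transpose_transpose m A :
  Forall (fun row => length row = m) A -> transpose (length A) (transpose m A) = A.
Proof.
  intros H. rewrite <- (map_nth_seq [] A) at 3. unfold transpose. apply map_ext_in.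
  intros i Hi. apply in_seq in Hi. rewrite map_map.
  assert (Hl : length (nth i A []) = m).
  { rewrite Forall_forall in H. apply H, nth_In. lia. }
  rewrite <- (map_nth_seq 0%nat (nth i A [])), Hl at 1. apply map_ext. intros k.
  rewrite (nth_indep _ 0%nat (nth k (@nil nat) 0%nat)) by (rewrite length_map; lia).
  exact (map_nth (fun row => nth k row 0%nat) A [] i).
Qed.

Lemma transpose_firstn n A : transpose n (map (firstn n) A) = transpose n A.
Proof.
  unfold transpose. apply map_ext_in. intros k Hk. apply in_seq in Hk. rewrite map_map.
  apply map_ext. intros row. rewrite nth_firstn. destruct (Nat.ltb_spec k n); [reflexivity|lia].
Qed.

Lemma rbb_chain_lengths L x r : rbb_chain L x r <> 0 -> Forall (fun y => length y = L) r.
Proof.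
  revert x. induction r as [|y r IH]; intros x H; constructor; simpl in H.
  - apply NNPP. intros E. apply H. assert (rbb_kernel L x y = 0) as ->; [|ring].
    apply NNPP. intros HK. now apply rbb_kernel_support in HK.
  - apply (IH y). intros E. apply H. rewrite E. ring.
Qed.

(** Prescribing the first [n] trajectories amounts to prescribing the first [n] bins at each time,
    namely [z :: zs]. *)
Lemma rbb_path_prefix L n p T ps z zs path :
  (n <= L)%nat -> (forall x, length x <> L -> p x = 0) ->
  length ps = n -> Forall (fun w => length w = (T + 1)%nat) ps -> z :: zs = transpose (T + 1) ps ->
  (if ceq (transpose n path) ps
   then if Nat.eqb (length path) (T + 1) then rbb_path L p path else 0 else 0)
  = prefix_path L n (restrict n z p) zs path.
Proof.
  intros Hn Hs Hl Hps Ez. destruct path as [|x r].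
  { cbn [rbb_path prefix_path]. now destruct ceq, Nat.eqb. }
  (* Null paths are dismissed first: a nonzero weight forces all states to have [L] entries, so each
     prefix has exactly [n], as inverting the transposition requires. *)
  destruct (Req_dec (p x * rbb_chain L x r) 0) as [E|E].
  { transitivity 0; [cbn [rbb_path]; now destruct ceq, Nat.eqb|]. unfold prefix_path, restrict.
    destruct (ceq (map (firstn n) r) zs), (list_eq_dec Nat.eq_dec (firstn n x) z); auto; ring. }
  assert (Hall : Forall (fun y => length y = n) (map (firstn n) (x :: r))).
  { apply Forall_map.
    assert (A : Forall (fun y => length y = L) (x :: r)).
    { constructor.
      - apply NNPP. intros Hx. apply E. rewrite (Hs x Hx). ring.
      - apply rbb_chain_lengths with x. intros F. apply E. rewrite F. ring. }
    apply Forall_impl with (2 := A). intros y Hy. rewrite length_firstn. lia. }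
  assert (Eq : (transpose n (x :: r) = ps /\ length (x :: r) = (T + 1)%nat) <->
               (firstn n x = z /\ map (firstn n) r = zs)).
  { assert (Eq' : (firstn n x = z /\ map (firstn n) r = zs) <-> map (firstn n) (x :: r) = transpose (T + 1) ps).
    { rewrite <- Ez. simpl. split; [intros [-> ->]; reflexivity|intros [= -> ->]; auto]. }
    rewrite Eq'. split.
    - intros [F1 F2]. assert (Q := transpose_transpose n _ Hall).
      rewrite transpose_firstn, length_map, F2, F1 in Q. now symmetry.
    - intros F. split.
      + assert (Q := transpose_transpose (T + 1) ps Hps).
        rewrite Hl, <- F, transpose_firstn in Q. exact Q.
      + rewrite <- (length_map (firstn n)), F. apply transpose_length. }
  simpl rbb_path. unfold prefix_path, restrict.
  destruct ceq as [F1|F1], (Nat.eqb_spec (length (x :: r)) (T + 1)) as [F2|F2],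
    (ceq (map (firstn n) r) zs) as [G1|G1], (list_eq_dec Nat.eq_dec (firstn n x) z) as [G2|G2];
    try ring; exfalso; tauto.
Qed.

Lemma Rprod_combine (h : nat -> nat -> R) z z' : length z = length z' ->
  Rprod (map (fun p => h (fst p) (snd p)) (combine z z')) =
  Rprod (map (fun k => h (nth k z 0%nat) (nth k z' 0%nat)) (seq 0 (length z))).
Proof.
  revert z'. induction z as [|a z IH]; intros [|b z'] H; try discriminate; [reflexivity|].
  injection H as H. cbn [combine map length seq fst snd]. rewrite <- seq_shift, map_map.
  specialize (IH z' H). unfold Rprod in *. simpl. now rewrite IH.
Qed.

(** A product over times of products over bins, taken in the other order. *)
Lemma nl_weight_prod mu n zs : Forall (fun z => length z = n) zs -> forall t z, length z = n ->
  nl_weight mu t z zs =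
  Rprod (map (fun k => nl_chain mu t (nth k z 0%nat) (map (fun w => nth k w 0%nat) zs)) (seq 0 n)).
Proof.
  induction 1 as [|z' zs Hz' Hzs IH]; intros t z Hz; simpl.
  - generalize (seq 0 n). intros l. induction l; simpl; [reflexivity|]. rewrite <- IHl. ring.
  - rewrite (IH (S t) z' Hz'), Rprod_combine, Hz by congruence. symmetry. apply Rprod_map_mult.
Qed.

Lemma nl_path_prod mu z zs n : length z = n -> Forall (fun z => length z = n) zs ->
  Rprod (map mu z) * nl_weight mu 0 z zs = Rprod (map (nl_path mu) (transpose n (z :: zs))).
Proof.
  intros Hz Hzs. rewrite (nl_weight_prod mu n) by auto.
  rewrite <- (map_nth_seq 0%nat z) at 1. rewrite Hz, map_map, <- Rprod_map_mult.
  unfold transpose. now rewrite map_map.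
Qed.

(** * Convergence of expectations *)

Lemma has_sum_cons_dominated {X : Type} (f h : list X -> R) (F K : X -> R) s r :
  (forall l, Rabs (f l) <= h l) -> h [] = 0 ->
  (forall a, has_sum (fun l => h (a :: l)) (K a)) -> has_sum K r ->
  (forall a, has_sum (fun l => f (a :: l)) (F a)) -> has_sum F s -> has_sum f s.
Proof.
  intros Hfh H0 HK Hr HF Hs.
  assert (B : forall l, - h l <= f l <= h l) by (intros l; specialize (Hfh l); revert Hfh; unfold Rabs; destruct Rcase_abs; lra).
  assert (S1 : has_sum (fun l => f l + h l) (s + r)).
  { apply has_sum_cons with (F := fun a => F a + K a).
    - intros l. specialize (B l). lra.
    - specialize (B []). lra.
    - intros a. now apply (has_sum_plus (fun l => f (a :: l))).
    - now apply has_sum_plus. }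
  assert (S2 : has_sum h r).
  { apply has_sum_cons with (F := K); auto. intros l. specialize (B l). lra. }
  replace s with (s + r - r) by ring.
  apply has_sum_ext with (fun l => f l + h l - h l); [intros; ring|]. now apply has_sum_minus.
Qed.

(** Fubini for a product of absolutely summable functions on [n]-tuples. *)
Lemma has_sum_tuples {X : Type} (d : X) n : forall (G g : nat -> X -> R) (v b : nat -> R),
  (forall k, (k < n)%nat -> (forall x, Rabs (G k x) <= g k x) /\ has_sum (g k) (b k) /\ has_sum (G k) (v k)) ->
  has_sum (fun ps => if Nat.eqb (length ps) n then Rprod (map (fun k => G k (nth k ps d)) (seq 0 n)) else 0)
          (Rprod (map v (seq 0 n))).
Proof.
  (* The dominating product is carried through the induction, because [has_sum_cons_dominated] asks
     for its sum. *)
  enough (K : forall (G g : nat -> X -> R) (v b : nat -> R),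
    (forall k, (k < n)%nat -> (forall x, Rabs (G k x) <= g k x) /\ has_sum (g k) (b k) /\ has_sum (G k) (v k)) ->
    has_sum (fun ps => if Nat.eqb (length ps) n then Rprod (map (fun k => g k (nth k ps d)) (seq 0 n)) else 0)
          (Rprod (map b (seq 0 n))) /\
    has_sum (fun ps => if Nat.eqb (length ps) n then Rprod (map (fun k => G k (nth k ps d)) (seq 0 n)) else 0)
          (Rprod (map v (seq 0 n)))).
  { intros G g v b H. now apply (K G g v b). }
  induction n as [|n IH]; intros G g v b H.
  - split; apply (has_sum_single (fun ps : list X => if Nat.eqb (length ps) 0 then 1 else 0) []);
    intros [|a ps] Hp; simpl; congruence.
  - destruct (IH (fun k => G (S k)) (fun k => g (S k)) (fun k => v (S k)) (fun k => b (S k))) as [I1 I2].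
    { intros k Hk. apply (H (S k)). lia. }
    destruct (H 0%nat ltac:(lia)) as (Hd & Hb & Hv).
    assert (E : forall (u : nat -> R), Rprod (map u (seq 0 (S n))) = u 0%nat * Rprod (map (fun k => u (S k)) (seq 0 n))).
    { intros u. cbn [seq map]. rewrite <- seq_shift, map_map. reflexivity. }
    assert (R1 : forall a, has_sum (fun ps => if Nat.eqb (length (a :: ps)) (S n)
       then Rprod (map (fun k => g k (nth k (a :: ps) d)) (seq 0 (S n))) else 0)
         (Rprod (map (fun k => b (S k)) (seq 0 n)) * g 0%nat a)).
    { intros a. rewrite Rmult_comm. eapply has_sum_ext; [|apply has_sum_scal, I1].
      intros ps. rewrite E. simpl. destruct Nat.eqb; ring. }
    assert (R2 : forall a, has_sum (fun ps => if Nat.eqb (length (a :: ps)) (S n)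
       then Rprod (map (fun k => G k (nth k (a :: ps) d)) (seq 0 (S n))) else 0)
         (Rprod (map (fun k => v (S k)) (seq 0 n)) * G 0%nat a)).
    { intros a. rewrite Rmult_comm. eapply has_sum_ext; [|apply has_sum_scal, I2].
      intros ps. rewrite E. simpl. destruct Nat.eqb; ring. }
    assert (P : forall ps, Rabs (Rprod (map (fun k => G k (nth k ps d)) (seq 0 (S n)))) <=
                Rprod (map (fun k => g k (nth k ps d)) (seq 0 (S n)))).
    { intros ps. clear - H.
      assert (Hin : forall k, In k (seq 0 (S n)) -> Rabs (G k (nth k ps d)) <= g k (nth k ps d)).
      { intros k Hk. apply in_seq in Hk. now apply H. }
      revert Hin. generalize (seq 0 (S n)). intros l. induction l as [|k l IH]; intros Hin; simpl; [rewrite Rabs_R1; lra|].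
      rewrite Rabs_mult. apply Rmult_le_compat; try apply Rabs_pos; [apply Hin; now left|].
      apply IH. intros; apply Hin; now right. }
    split.
    + apply has_sum_cons with (F := fun a => Rprod (map (fun k => b (S k)) (seq 0 n)) * g 0%nat a); auto.
      * intros ps. destruct Nat.eqb; [|lra]. eapply Rle_trans; [apply Rabs_pos|apply P].
      * rewrite E, Rmult_comm. now apply has_sum_scal.
    + apply has_sum_cons_dominated with (K := fun a => Rprod (map (fun k => b (S k)) (seq 0 n)) * g 0%nat a) (F := fun a => Rprod (map (fun k => v (S k)) (seq 0 n)) * G 0%nat a) (h := fun ps => if Nat.eqb (length ps) (S n)
        then Rprod (map (fun k => g k (nth k ps d)) (seq 0 (S n))) else 0)
        (r := Rprod (map (fun k => b (S k)) (seq 0 n)) * b 0%nat).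
      * intros ps. destruct Nat.eqb; [apply P|rewrite Rabs_R0; lra].
      * reflexivity.
      * exact R1.
      * apply has_sum_scal, Hb.
      * exact R2.
      * rewrite E, Rmult_comm. now apply has_sum_scal.
Qed.

(** Change of variables for the push-forward [W] of [w]. Shifting [h] by [B] makes it nonnegative,
    and the total mass 1 accounts for the shift. *)
Lemma has_sum_fibres_weighted {X Y : Type} (p : X -> Y) (w : X -> R) (W h : Y -> R) B e :
  (forall x, 0 <= w x) -> (forall y, Rabs (h y) <= B) ->
  (forall y, has_sum (fun x => if ceq (p x) y then w x else 0) (W y)) -> has_sum w 1 ->
  has_sum (fun x => w x * h (p x)) e -> has_sum (fun y => W y * h y) e.
Proof.
  intros Hw Hh HW H1 He.
  assert (B' : forall y, 0 <= h y + B) by (intros y; specialize (Hh y); revert Hh; unfold Rabs; destruct Rcase_abs; lra).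
  assert (S1 : has_sum W 1) by (apply (has_sum_fibres p w W 1 Hw HW); exact H1).
  assert (S2 : has_sum (fun y => W y * (h y + B)) (e + B * 1)).
  { apply (has_sum_fibres p (fun x => w x * (h (p x) + B)) (fun y => W y * (h y + B))).
    - intros x. now apply Rmult_le_pos.
    - intros y. rewrite Rmult_comm. eapply has_sum_ext; [|apply has_sum_scal, (HW y)].
      intros x. cbv beta. destruct ceq as [<-|]; ring.
    - apply has_sum_ext with (fun x => w x * h (p x) + B * w x); [intros; ring|].
      apply has_sum_plus; [exact He|]. now apply has_sum_scal. }
  replace e with (e + B * 1 - B * 1) by ring.
  apply has_sum_ext with (fun y => W y * (h y + B) - B * W y); [intros; ring|].
  apply has_sum_minus; [exact S2|]. now apply has_sum_scal.
Qed.

Lemma Un_cv_Rsum {X : Type} (u : X -> nat -> R) (l : X -> R) S :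
  (forall x, In x S -> Un_cv (u x) (l x)) ->
  Un_cv (fun n => Rsum (map (fun x => u x n) S)) (Rsum (map l S)).
Proof.
  induction S as [|x S IH]; intros H; simpl; [apply Un_cv_const|].
  apply (CV_plus (u x)); [apply H; now left|apply IH; intros; apply H; now right].
Qed.

(* Scheffe: the limit has full mass, so pointwise convergence leaves no mass outside a large finite set. *)
Lemma scheffe {X : Type} (pL : nat -> X -> R) (p h : X -> R) (e : nat -> R) v B :
  (forall L x, (1 <= L)%nat -> 0 <= pL L x) -> (forall L, (1 <= L)%nat -> has_sum (pL L) 1) ->
  (forall x, 0 <= p x) -> has_sum p 1 ->
  (forall x, p x <> 0 -> Un_cv (fun L => pL L x) (p x)) ->
  (forall x, Rabs (h x) <= B) ->
  (forall L, (1 <= L)%nat -> has_sum (fun x => pL L x * h x) (e L)) ->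
  has_sum (fun x => p x * h x) v -> Un_cv e v.
Proof.
  intros HpL SpL Hp Sp Hcv Hh He Hv eps Heps.
  assert (HB : 0 <= B).
  { destruct (classic (exists x : X, True)) as [[x _]|Hn].
    - eapply Rle_trans; [apply Rabs_pos|apply (Hh x)].
    - exfalso. assert (A : has_sum p 0).
      { eapply has_sum_ext; [|apply has_sum_zero]. intros x. exfalso. eauto. }
      pose proof (has_sum_unique _ _ _ A Sp). lra. }
  (* The final bound is [4 B d], strictly below [5 (B + 1) d = eps] even when [B = 0]. *)
  set (d := eps / (5 * (B + 1))). assert (Hd : 0 < d) by (apply Rdiv_lt_0_compat; lra).
  destruct (Sp d Hd) as [S1 HS1].
  (* Convergence is assumed only where [p] is nonzero; discarding the zeros leaves the mass of the
     list unchanged. *)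
  set (S2 := nodup ceq S1). set (S := filter (fun x => if Req_EM_T (p x) 0 then false else true) S2).
  assert (N2 : NoDup S2) by apply NoDup_nodup.
  assert (N : NoDup S) by now apply NoDup_filter.
  specialize (HS1 S2 N2 (fun x Hx => proj2 (nodup_In ceq S1 x) Hx)).
  rewrite (Rsum_incl_zero p S S2) in HS1; auto.
  2:{ intros x Hx. now apply filter_In in Hx. }
  2:{ intros x Hx Hn. apply NNPP. intros Ex. apply Hn. apply filter_In. split; [exact Hx|]. now destruct Req_EM_T. }
  assert (U : Un_cv (fun L => Rsum (map (fun x => Rabs (pL L x - p x)) S)) (Rsum (map (fun x => 0) S))).
  { apply (Un_cv_Rsum (fun x L => Rabs (pL L x - p x)) (fun _ => 0)).
    intros x Hx. apply filter_In in Hx. destruct Hx as [_ Hx]. destruct Req_EM_T as [|Hx']; [discriminate|].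
    intros r Hr. destruct (Hcv x Hx' r Hr) as [N0 HN0]. exists N0. intros L HL. specialize (HN0 L HL).
    unfold Rdist in *. rewrite Rminus_0_r, Rabs_Rabsolu. exact HN0. }
  rewrite Rsum_map_const, Rmult_0_r in U.
  destruct (U d Hd) as [N0 HN0]. exists (1 + N0)%nat. intros L HL. specialize (HN0 L ltac:(lia)).
  assert (HL1 : (1 <= L)%nat) by lia.
  unfold Rdist in *. rewrite Rminus_0_r in HN0.
  set (del := Rsum (map (fun x => Rabs (pL L x - p x)) S)) in *.
  assert (Hdel : del < d) by (apply Rabs_def2 in HN0; lra).
  set (on := fun (a : X -> R) x => if excluded_middle_informative (In x S) then a x else 0).
  assert (Hon : forall a, has_sum (on a) (Rsum (map a S))).
  { intros a. rewrite (Rsum_map_ext a (on a)).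
    - apply has_sum_finite; [exact N|]. intros x Hx. unfold on. destruct excluded_middle_informative; tauto.
    - intros x Hx. unfold on. destruct excluded_middle_informative; tauto. }
  assert (Hdiff : has_sum (fun x => pL L x * h x - p x * h x) (e L - v)) by (apply has_sum_minus; auto).
  (* Inside [S] the difference is bounded by [|pL - p|], outside by [pL + p], whose outside masses
     are complements of finite sums. *)
  assert (Hdom : has_sum (fun x => B * (on (fun x => Rabs (pL L x - p x)) x + ((pL L x - on (pL L) x) + (p x - on p x))))
     (B * (del + ((1 - Rsum (map (pL L) S)) + (1 - Rsum (map p S)))))).
  { apply has_sum_scal, has_sum_plus; [apply Hon|]. apply has_sum_plus; apply has_sum_minus; auto. }
  edestruct (has_sum_dominated (fun x => pL L x * h x - p x * h x)) with (2 := Hdom) as (s & Hs & Hle).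
  { intros x. rewrite <- Rmult_minus_distr_r, Rabs_mult, Rmult_comm.
    specialize (HpL L x HL1). specialize (Hp x).
    apply Rmult_le_compat; try apply Rabs_pos; [apply Hh|].
    unfold on. destruct excluded_middle_informative; [lra|]. unfold Rabs. destruct Rcase_abs; lra. }
  rewrite (has_sum_unique _ _ _ Hdiff Hs).
  (* [pL] leaves outside [S] at most [del] more mass than [p] does. *)
  assert (D : Rsum (map p S) - Rsum (map (pL L) S) <= del).
  { assert (A : Rsum (map p S) <= Rsum (map (pL L) S) + del).
    { unfold del. rewrite <- Rsum_map_plus. apply Rsum_map_le. intros x _.
      pose proof (Rle_abs (- (pL L x - p x))). rewrite Rabs_Ropp in H. lra. }
    lra. }
  apply Rabs_def2 in HS1.
  assert (Q : B * (del + (1 - Rsum (map (pL L) S) + (1 - Rsum (map p S)))) <= B * (4 * d)).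
  { apply Rmult_le_compat_l; [exact HB|]. lra. }
  assert (Q2 : 5 * ((B + 1) * d) = eps) by (unfold d; field; lra). nra.
Qed.

Theorem theorem3p1
  (p0 : nat -> list nat -> R) (mu : nat -> R)
  (* p0 L is the (exchangeable) law of eta^L(0) on Z_+^L *)
  (Hp0_nonneg : forall L x, (1 <= L)%nat -> 0 <= p0 L x)
  (Hp0_supp : forall L x, (1 <= L)%nat -> length x <> L -> p0 L x = 0)
  (Hp0_prob : forall L, (1 <= L)%nat -> has_sum (p0 L) 1)
  (Hp0_exch : forall L x y, (1 <= L)%nat -> Permutation x y -> p0 L x = p0 L y)
  (* mu is a probability measure on Z_+ *)
  (Hmu_nonneg : forall k, 0 <= mu k)
  (Hmu_prob : infinite_sum mu 1)
  (* chaos of the initial condition *)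
  (Hchaos : forall xi : list nat, (1 <= length xi)%nat ->
     exists m : nat -> R,
       (forall L, (1 <= L)%nat ->
          has_sum (fun x => if list_eq_dec Nat.eq_dec (firstn (length xi) x) xi
                            then p0 L x else 0) (m L)) /\
       Un_cv m (Rprod (map mu xi))) :
  (forall L t x y, (1 <= L)%nat -> Permutation x y ->
     rbb_law L (p0 L) t x = rbb_law L (p0 L) t y) /\
  (forall (T n : nat) (Phi : nat -> list nat -> R),
     (1 <= T)%nat -> (1 <= n)%nat ->
     (exists M, forall k v, (k < n)%nat -> Rabs (Phi k v) <= M) ->
     exists (e : nat -> R) (v : nat -> R),
       (forall k, (k < n)%nat ->
          has_sum (fun path : list nat =>
                     if Nat.eqb (length path) (T + 1)
                     then nl_path mu path * Phi k path else 0) (v k)) /\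
       (forall L, (1 <= L)%nat ->
          has_sum (fun path : list (list nat) =>
                     if Nat.eqb (length path) (T + 1)
                     then rbb_path L (p0 L) path *
                          Rprod (map (fun k => Phi k (map (fun x => nth k x 0%nat) path))
                                     (seq 0 n))
                     else 0) (e L)) /\
       Un_cv e (Rprod (map v (seq 0 n)))).
Proof.
  assert (Hinit : forall xi, (1 <= length xi)%nat ->
    mass_limit (length xi) (fun L => restrict (length xi) xi (p0 L)) (Rprod (map mu xi))).
  { intros xi Hxi. destruct (Hchaos xi Hxi) as (m & Hm & Lm). exists m. split; [|exact Lm].
    intros L HL _. now apply Hm. }
  split.
  { intros L t x y HL. apply rbb_law_perm. intros; now apply Hp0_exch. }
  intros T n Phi HT Hn (M & HM).
  set (g := fun w => if Nat.eqb (length w) (T + 1) then nl_path mu w else 0).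
  set (G := fun k w => if Nat.eqb (length w) (T + 1) then nl_path mu w * Phi k w else 0).
  assert (g0 : forall w, 0 <= g w).
  { intros w. unfold g. destruct Nat.eqb; [now apply nl_path_nonneg|lra]. }
  assert (g1 : has_sum g 1) by now apply nl_path_sum.
  assert (GM : forall k, (k < n)%nat -> forall w, Rabs (G k w) <= M * g w).
  { intros k Hk w. unfold G, g. destruct Nat.eqb; [|rewrite Rabs_R0; lra].
    rewrite Rabs_mult, Rabs_pos_eq, Rmult_comm by now apply nl_path_nonneg.
    apply Rmult_le_compat_r; [now apply nl_path_nonneg|now apply HM]. }
  set (v := fun k => total (G k)).
  assert (Hv : forall k, (k < n)%nat -> has_sum (G k) (v k)).
  { intros k Hk. apply total_spec.
    destruct (has_sum_dominated (G k) (fun w => M * g w) M) as (s & Hs & _); eauto. now apply has_sum_scal1. }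
  set (w := fun L path => if Nat.eqb (length path) (T + 1) then rbb_path L (p0 L) path else 0).
  assert (w0 : forall L path, (1 <= L)%nat -> 0 <= w L path).
  { intros L path HL. unfold w. destruct Nat.eqb; [|lra]. destruct path as [|x r]; simpl; [lra|].
    apply Rmult_le_pos; [now apply Hp0_nonneg|now apply rbb_chain_nonneg]. }
  assert (w1 : forall L, (1 <= L)%nat -> has_sum (w L) 1) by (intros; apply rbb_path_sum; auto).
  set (h := fun ps : list (list nat) => Rprod (map (fun k => Phi k (nth k ps [])) (seq 0 n))).
  assert (hM : forall ps, Rabs (h ps) <= M ^ n).
  { intros ps. unfold h. rewrite <- (length_seq n 0) at 2. apply Rprod_map_Rabs_le.
    intros k Hk. apply in_seq in Hk. apply HM. lia. }
  (* When [L < n] the missing bins read as 0 on both sides, so the expectation makes sense for every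
     [L >= 1]. *)
  assert (hE : forall path : list (list nat),
    Rprod (map (fun k => Phi k (map (fun x => nth k x 0%nat) path)) (seq 0 n)) = h (transpose n path)).
  { intros path. apply Rprod_map_ext. intros k Hk. apply in_seq in Hk. f_equal. unfold transpose.
    rewrite (nth_indep _ [] (map (fun x => nth 0 x 0%nat) path)) by (rewrite length_map, length_seq; lia).
    rewrite (map_nth (fun k => map (fun x => nth k x 0%nat) path)), seq_nth by lia. reflexivity. }
  set (e := fun L => total (fun path => w L path * h (transpose n path))).
  assert (He : forall L, (1 <= L)%nat -> has_sum (fun path => w L path * h (transpose n path)) (e L)).
  { intros L HL. apply total_spec.
    destruct (has_sum_dominated (fun path => w L path * h (transpose n path)) (fun path => M ^ n * w L path) (M ^ n))
      as (s & Hs & _); eauto; [|now apply has_sum_scal1, w1].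
    intros path. rewrite Rabs_mult, (Rabs_pos_eq (w L path)), Rmult_comm by auto.
    apply Rmult_le_compat_r; auto. }
  exists e, v. split; [exact Hv|]. split.
  { intros L HL. eapply has_sum_ext; [|exact (He L HL)]. intros path. cbv beta. rewrite hE.
    unfold w. destruct Nat.eqb; ring. }
  (* [W L] is the joint law of the first [n] trajectories and [p] below that of [n] independent
     nonlinear ones; it remains to apply [scheffe] to them. *)
  set (W := fun L ps => total (fun path => if ceq (transpose n path) ps then w L path else 0)).
  assert (HW : forall L ps, (1 <= L)%nat ->
    has_sum (fun path => if ceq (transpose n path) ps then w L path else 0) (W L ps)).
  { intros L ps HL. apply total_spec.
    destruct (has_sum_dominated_nonneg (fun path => if ceq (transpose n path) ps then w L path else 0) (w L) 1)
      as (s & Hs & _); eauto.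
    intros path. specialize (w0 L path HL). destruct ceq; lra. }
  set (p := fun ps : list (list nat) => if Nat.eqb (length ps) n
              then Rprod (map (fun k => g (nth k ps [])) (seq 0 n)) else 0).
  apply (scheffe W p h) with (B := M ^ n).
  - intros L ps HL. eapply has_sum_nonneg; [|apply HW; exact HL].
    intros path. cbv beta. specialize (w0 L path HL). destruct ceq; lra.
  - intros L HL. apply (has_sum_fibres (transpose n) (w L)); auto.
  - intros ps. unfold p. destruct Nat.eqb; [|lra]. apply Rprod_map_nonneg. auto.
  - assert (K := has_sum_tuples (@nil nat) n (fun _ => g) (fun _ => g) (fun _ => 1) (fun _ => 1)).
    assert (E1 : Rprod (map (fun _ : nat => 1) (seq 0 n)) = 1).
    { generalize (seq 0 n). intros l. induction l as [|a l IHl]; simpl; [reflexivity|]. unfold Rprod in IHl |- *. rewrite IHl. ring. }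
    rewrite E1 in K. apply K. intros k _. repeat split; auto. intros x. rewrite Rabs_pos_eq; auto; lra.
  - intros ps Hps. unfold p in Hps |- *. destruct (Nat.eqb_spec (length ps) n) as [Hl|]; [|tauto].
    (* A tuple charged by [p] has all its trajectories of length [T + 1]; transposing them gives the
       prefixes to be followed. *)
    assert (Hall : Forall (fun u => length u = (T + 1)%nat) ps).
    { apply Forall_forall. intros u Hu. apply NNPP. intros Hne. apply Hps.
      destruct (In_nth ps u [] Hu) as (k & Hk & <-).
      assert (Hin : In k (seq 0 n)) by (apply in_seq; lia).
      destruct (in_split _ _ Hin) as (l1 & l2 & ->). rewrite map_app, Rprod_app. simpl.
      unfold g at 2. destruct (Nat.eqb_spec (length (nth k ps [])) (T + 1)); [tauto|ring]. }
    assert (Ep : Rprod (map (fun k => g (nth k ps [])) (seq 0 n)) = Rprod (map (nl_path mu) ps)).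
    { rewrite <- (map_map (fun k => nth k ps []) g), <- Hl, map_nth_seq. apply Rprod_map_ext.
      intros u Hu. unfold g. rewrite Forall_forall in Hall. rewrite (Hall u Hu), Nat.eqb_refl. reflexivity. }
    rewrite Ep. destruct (transpose (T + 1) ps) as [|z zs] eqn:Ez.
    { apply (f_equal (@length _)) in Ez. rewrite transpose_length in Ez. simpl in Ez. lia. }
    assert (Hrows : Forall (fun u => length u = n) (z :: zs)).
    { apply Forall_forall. intros u Hu. rewrite <- Ez in Hu. now rewrite (transpose_rows _ _ _ Hu). }
    inversion Hrows as [|? ? Hz Hzs]; subst.
    assert (Hi : mass_limit (length ps) (fun L => restrict (length ps) z (p0 L)) (Rprod (map mu z)))
      by (rewrite <- Hz; apply Hinit; lia).
    destruct (steps_mass_limit p0 mu Hp0_nonneg Hp0_supp Hp0_prob Hp0_exch Hmu_nonneg Hmu_prob Hinit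
       (length ps) zs Hzs 0 z (fun L => restrict (length ps) z (p0 L)) (Rprod (map mu z)) Hz
       (fun L x HL => restrict_le _ _ _ _ (Hp0_nonneg L x HL))
       (fun L x _ => restrict_support _ _ _ x) Hi) as (m & Hm & Lm).
    rewrite (nl_path_prod mu z zs (length ps) Hz Hzs), <- Ez, transpose_transpose in Lm by exact Hall.
    (* [m] is meaningful only once [L] bins can hold the prefix; its earlier terms are arbitrary. *)
    apply (Un_cv_eventually m _ _ (1 + length ps)%nat); [|exact Lm].
    intros L HL. apply (has_sum_unique (prefix_path L (length ps) (restrict (length ps) z (p0 L)) zs)).
    + apply prefix_path_sum; [lia| |apply Hm; lia].
      intros x. apply restrict_le. apply Hp0_nonneg. lia.
    + eapply has_sum_ext; [|apply (HW L ps); lia]. intros path. cbv beta.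
      apply (rbb_path_prefix L (length ps) (p0 L) T); auto; [lia|]. intros x. apply Hp0_supp. lia.
  - exact hM.
  - intros L HL. apply has_sum_fibres_weighted with (p := transpose n) (w := w L) (B := M ^ n); auto.
  - assert (K := has_sum_tuples (@nil nat) n G (fun _ w => M * g w) v (fun _ => M)).
    eapply has_sum_ext; [|apply K].
    + intros ps. cbv beta. unfold p, h. destruct Nat.eqb; [|ring]. rewrite <- Rprod_map_mult.
      apply Rprod_map_ext. intros k _. unfold G, g. destruct Nat.eqb; ring.
    + intros k Hk. repeat split; auto. now apply has_sum_scal1.
Qed.
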